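(* Let $M$ be a closed manifold with a closed 2-form $\Omega$ with $0\neq[\Omega]\in H^2(M,\mathbb Z)$ such that the pullback of $\Omega$ to the universal cover $\widetilde M$ has a bounded primitive. Let $p:P\to M$ be a circle bundle with Euler class $[\Omega]$ and $\psi$ a connection 1-form on $P$ with $p^*\Omega=-d\psi$. Fix a Riemannian metric $h$ on $M$ and for $\varepsilon>0$ let $g_\varepsilon$ be the metric on $P$ given by $$g_\varepsilon(u,v)=\varepsilon^{-1}h(dp(u),dp(v))+\psi(u)\psi(v).$$ For $H=\frac12|p|_\varepsilon^2$ on $T^*P$ (with $|\cdot|_\varepsilon$ the dual norm of $g_\varepsilon$) and $\sigma=-d\psi$, the strict Mañé critical value satisfies $c_0(g_\varepsilon,\sigma)=1/2$ for all $\varepsilon>0$, but $c(g_\varepsilon,\sigma)\to0$ as $\varepsilon\to0$.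
   Context: A primitive $\theta$ on $\widetilde M$ is bounded if $\sup_{q\in\widetilde M}|\theta_q|<\infty$ with respect to the lift of a Riemannian metric on $M$. $0\ne[\Omega]$ means that the de Rham class of $\Omega$ is integral and nonzero. For the closed manifold $P$ and exact 2-form $\sigma$: $c_0(g_\varepsilon,\sigma)=\inf_\theta\sup_{q\in P}H(q,\theta_q)$, the infimum over 1-forms $\theta$ on $P$ with $d\theta=\sigma$; $c(g_\varepsilon,\sigma)=\inf_\theta\sup_{q\in\widetilde P}\widetilde H(q,\theta_q)$, the infimum over 1-forms $\theta$ on the universal cover $\widetilde P$ with $d\theta$ equal to the pullback of $\sigma$, $\widetilde H$ the lift of $H$. *)

(* Defs.v *)
From HB Require Import structures.
From mathcomp Require Import all_boot all_order all_algebra.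
From mathcomp Require Import all_classical all_reals all_analysis.

Set Implicit Arguments.
Unset Strict Implicit.
Unset Printing Implicit Defensive.
Import Order.TTheory GRing.Theory Num.Theory.
Import numFieldNormedType.Exports.

Local Open Scope classical_set_scope.
Local Open Scope ring_scope.

(** * Smooth maps between normed spaces *)

Fixpoint Ck (R : realType) (E F : normedModType R) (k : nat) (U : set E)
    (f : E -> F) : Prop :=
  match k with
  | 0%N => forall x, U x -> {for x, continuous f}
  | k'.+1 => (forall x, U x -> differentiable f x) /\
             (forall v : E, Ck k' U ('D_v f))
  end.

Definition smooth_at (R : realType) (E F : normedModType R) (f : E -> F)
    (x : E) : Prop :=
  exists2 U : set E, open_nbhs x U & forall k, Ck k U f.

(** * Smooth manifolds without boundary

   The inverse of a chart is a total function, meaningful only on the open set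
   [chart_fun @` chart_dom].  The smooth structure is given by an atlas
   [{chart_at x | x}] in which every point has a preferred chart around it; a
   tangent vector at [x] is represented by its coordinates in the chart
   [chart_at x], so that every tangent space [T_x M] is ['rV[R]_n]. *)

Record chart (R : realType) (T : topologicalType) (n : nat) := Chart {
  chart_dom : set T;
  chart_fun : T -> 'rV[R]_n;
  chart_inv : 'rV[R]_n -> T;
  chart_dom_open : open chart_dom;
  chart_img_open : open (chart_fun @` chart_dom);
  chart_fun_continuous :
    forall x, chart_dom x -> {for x, continuous chart_fun};
  chart_inv_continuous :
    forall y, (chart_fun @` chart_dom) y -> {for y, continuous chart_inv};
  chart_funK : forall x, chart_dom x -> chart_inv (chart_fun x) = x
}.

Record manifold (R : realType) (n : nat) := Manifold {
  mcarrier :> topologicalType;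
  chart_at : mcarrier -> chart R mcarrier n;
  mem_chart_at : forall x, chart_dom (chart_at x) x;
  chart_compat : forall x y z, chart_dom (chart_at x) z ->
    chart_dom (chart_at y) z ->
    smooth_at (chart_fun (chart_at y) \o chart_inv (chart_at x))
              (chart_fun (chart_at x) z);
  manifold_hausdorff : hausdorff_space mcarrier;
  manifold_second_countable : @second_countable mcarrier
}.

(* the coordinates of the point x in its preferred chart *)
Definition coord (R : realType) (n : nat) (M : manifold R n) (x : M) :
    'rV[R]_n := chart_fun (chart_at x) x.

(** ** Smooth maps and tangent maps *)

(* the expression near coord x of a map between manifolds *)
Definition local_expr (R : realType) (m n : nat) (M : manifold R m)
    (N : manifold R n) (f : M -> N) (x : M) : 'rV[R]_m -> 'rV[R]_n :=
  chart_fun (chart_at (f x)) \o f \o chart_inv (chart_at x).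

Definition smooth_map_at (R : realType) (m n : nat) (M : manifold R m)
    (N : manifold R n) (f : M -> N) (x : M) : Prop :=
  {for x, continuous f} /\ smooth_at (local_expr f x) (coord x).

Definition tangent (R : realType) (m n : nat) (M : manifold R m)
    (N : manifold R n) (f : M -> N) (x : M) : 'rV[R]_m -> 'rV[R]_n :=
  'd (local_expr f x) (coord x).

(* real-valued functions *)
Definition fun_expr (R : realType) (n : nat) (M : manifold R n) (f : M -> R)
    (x : M) : 'rV[R]_n -> R^o := f \o chart_inv (chart_at x).

Definition smooth_fun_at (R : realType) (n : nat) (M : manifold R n)
    (f : M -> R) (x : M) : Prop := smooth_at (fun_expr f x) (coord x).

Definition dfun (R : realType) (n : nat) (M : manifold R n) (f : M -> R)
    (x : M) (v : 'rV[R]_n) : R := 'd (fun_expr f x) (coord x) v.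

(** ** Covariant tensor fields of degree 1 and 2 *)

Definition field1 (R : realType) (n : nat) (M : manifold R n) :=
  M -> 'rV[R]_n -> R.
Definition field2 (R : realType) (n : nat) (M : manifold R n) :=
  M -> 'rV[R]_n -> 'rV[R]_n -> R.

(* If c is a chart and y = c z, [frame c y] turns coordinates with respect to c
   of tangent vectors at z into coordinates with respect to [chart_at z]. *)
Definition frame (R : realType) (n : nat) (M : manifold R n) (c : chart R M n)
    (y : 'rV[R]_n) : 'rV[R]_n -> 'rV[R]_n :=
  'd (chart_fun (chart_at (chart_inv c y)) \o chart_inv c) y.

(* components of tensor fields on constant vectors, in the chart c *)
Definition comp1 (R : realType) (n : nat) (M : manifold R n) (c : chart R M n)
    (t : field1 M) (u : 'rV[R]_n) : 'rV[R]_n -> R^o :=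
  fun y => t (chart_inv c y) (frame c y u).
Definition comp2 (R : realType) (n : nat) (M : manifold R n) (c : chart R M n)
    (w : field2 M) (u v : 'rV[R]_n) : 'rV[R]_n -> R^o :=
  fun y => w (chart_inv c y) (frame c y u) (frame c y v).

Definition form1_on (R : realType) (n : nat) (M : manifold R n) (U : set M)
    (t : field1 M) : Prop :=
  forall x, U x ->
    (forall a u v, t x (a *: u + v) = a * t x u + t x v) /\
    (forall u, smooth_at (comp1 (chart_at x) t u) (coord x)).

Definition form1 (R : realType) (n : nat) (M : manifold R n) (t : field1 M) :=
  form1_on setT t.

Definition form2 (R : realType) (n : nat) (M : manifold R n) (w : field2 M) :
    Prop :=
  forall x,
    [/\ forall a u v u', w x (a *: u + v) u' = a * w x u u' + w x v u',
        forall u v, w x u v = - w x v u &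
        forall u v, smooth_at (comp2 (chart_at x) w u v) (coord x)].

Definition riemannian_metric (R : realType) (n : nat) (M : manifold R n)
    (g : field2 M) : Prop :=
  forall x,
    [/\ forall a u v u', g x (a *: u + v) u' = a * g x u u' + g x v u',
        forall u v, g x u v = g x v u,
        forall u, u != 0 -> 0 < g x u u &
        forall u v, smooth_at (comp2 (chart_at x) g u v) (coord x)].

(* exterior derivative of 1-forms and of 2-forms *)
Definition ext1 (R : realType) (n : nat) (M : manifold R n) (t : field1 M) :
    field2 M :=
  fun x u v => 'D_u (comp1 (chart_at x) t v) (coord x)
             - 'D_v (comp1 (chart_at x) t u) (coord x).

Definition ext2 (R : realType) (n : nat) (M : manifold R n) (w : field2 M)
    (x : M) (u v z : 'rV[R]_n) : R :=
  'D_u (comp2 (chart_at x) w v z) (coord x)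
  - 'D_v (comp2 (chart_at x) w u z) (coord x)
  + 'D_z (comp2 (chart_at x) w u v) (coord x).

Definition closed_form2 (R : realType) (n : nat) (M : manifold R n)
    (w : field2 M) : Prop :=
  form2 w /\ forall x u v z, ext2 w x u v z = 0.

Definition primitive_of (R : realType) (n : nat) (M : manifold R n)
    (w : field2 M) (t : field1 M) : Prop :=
  form1 t /\ ext1 t = w.

Definition exact_form2 (R : realType) (n : nat) (M : manifold R n)
    (w : field2 M) : Prop := exists t, primitive_of w t.

Definition pullback2 (R : realType) (m n : nat) (M : manifold R m)
    (N : manifold R n) (f : M -> N) (w : field2 N) : field2 M :=
  fun x u v => w (f x) (tangent f x u) (tangent f x v).

(** ** Integrality of a de Rham class

   [w] lies in the image of Cech cohomology with integer coefficients: its image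
   under the Cech-de Rham zigzag
     w = d (lam i),  lam j - lam i = d (f i j),  (delta f) i j k
   can be chosen to be an integer-valued 2-cocycle of some open cover. *)
Definition integral_class (R : realType) (n : nat) (M : manifold R n)
    (w : field2 M) : Prop :=
  exists (I : Type) (U : I -> set M) (lam : I -> field1 M)
         (f : I -> I -> M -> R),
  [/\ (forall i, open (U i)) /\ \bigcup_i U i = setT,
      forall i, form1_on (U i) (lam i) /\
        forall x, U i x -> ext1 (lam i) x = w x,
      forall i j x, U i x -> U j x ->
        smooth_fun_at (f i j) x /\
        (forall v, dfun (f i j) x v = lam j x v - lam i x v) &
      forall i j k x, U i x -> U j x -> U k x ->
        f j k x - f i k x + f i j x \is a Num.int].

(** ** Universal covers *)

(* Every path, loop or homotopy defined on [0, 1] or [0, 1]^2 extends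
   continuously to R or R^2 (precompose with the retraction), hence the total
   functions. *)
Definition simply_connected (R : realType) (X : topologicalType) : Prop :=
  [/\ [set: X] !=set0,
      forall x y : X, exists gam : R -> X,
        [/\ continuous gam, gam 0 = x & gam 1 = y] &
      forall gam : R -> X, continuous gam -> gam 0 = gam 1 ->
        exists H : R * R -> X, continuous H /\
          forall s t, s \in `[0, 1] -> t \in `[0, 1] ->
            [/\ H (0, t) = gam t, H (1, t) = gam 0,
                H (s, 0) = gam 0 & H (s, 1) = gam 0]].

Definition smooth_covering (R : realType) (n : nat) (E B : manifold R n)
    (pr : E -> B) : Prop :=
  [/\ forall x, smooth_map_at pr x,
      set_surj [set: E] [set: B] pr &
      forall b : B, exists2 U : set B, open_nbhs b U &
        exists S : set (set E),
        [/\ forall V, S V -> open V,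
            forall V W, S V -> S W -> V `&` W !=set0 -> V = W,
            \bigcup_(V in S) V = pr @^-1` U &
            forall V, S V -> exists s : B -> E,
              [/\ forall y, U y -> smooth_map_at s y,
                  forall y, U y -> V (s y) /\ pr (s y) = y &
                  forall x, V x -> s (pr x) = x]]].

Definition universal_cover (R : realType) (n : nat) (E B : manifold R n)
    (pr : E -> B) : Prop :=
  smooth_covering pr /\ simply_connected R E.

(** ** Principal circle bundles

   The circle is R / Z; its action on the total space is written as an action
   of R.  A local section [s] on [U] yields the local trivialisation
   [(x, t) |-> act t (s x)] of the bundle over [U]. *)

Definition action_expr (R : realType) (n : nat) (P : manifold R n)
    (act : R -> P -> P) (t : R) (q : P) : (R^o * 'rV[R]_n)%type -> 'rV[R]_n :=
  fun z => chart_fun (chart_at (act t q))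
             (act z.1 (chart_inv (chart_at q) z.2)).

Definition smooth_action (R : realType) (n : nat) (P : manifold R n)
    (act : R -> P -> P) : Prop :=
  forall (t : R) (q : P),
    {for (t, q), continuous (fun z : R * P => act z.1 z.2)} /\
    smooth_at (action_expr act t q) (t, coord q).

Definition circle_bundle (R : realType) (m n : nat) (P : manifold R m)
    (M : manifold R n) (p : P -> M) (act : R -> P -> P) : Prop :=
  [/\ (forall q, smooth_map_at p q) /\ smooth_action act,
      (forall q, act 0 q = q) /\
        (forall s t q, act (s + t) q = act s (act t q)),
      forall t q, act t q = q <-> t \is a Num.int,
      forall q q', p q = p q' <-> exists t, q' = act t q &
      forall b : M, exists2 U : set M, open_nbhs b U &
        exists s : M -> P, forall x, U x -> smooth_map_at s x /\ p (s x) = x].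

(* the vector field generating the circle action, of period 1 *)
Definition generator (R : realType) (n : nat) (P : manifold R n)
    (act : R -> P -> P) (q : P) : 'rV[R]_n :=
  derive1 (fun t : R => chart_fun (chart_at q) (act t q)) 0.

Definition connection_form (R : realType) (n : nat) (P : manifold R n)
    (act : R -> P -> P) (psi : field1 P) : Prop :=
  [/\ form1 psi,
      forall t q v, psi (act t q) (tangent (act t) q v) = psi q v &
      forall q, psi q (generator act q) = 1].

(* Chern-Weil: the Euler class in de Rham cohomology is the class of any closed
   2-form eta with p^* eta = - d psi0 for some connection form psi0.  As the
   circle is R / Z with psi0 equal to 1 on the generator of period 1, this class
   is integral without further normalisation. *)
Definition has_euler_class (R : realType) (m n : nat) (P : manifold R m)
    (M : manifold R n) (p : P -> M) (act : R -> P -> P) (w : field2 M) : Prop :=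
  exists (psi0 : field1 P) (eta : field2 M),
    [/\ connection_form act psi0, closed_form2 eta,
        pullback2 p eta = (fun q u v => - ext1 psi0 q u v) &
        exact_form2 (fun x u v => eta x u v - w x u v)].

Definition bundle_metric (R : realType) (m n : nat) (P : manifold R m)
    (M : manifold R n) (p : P -> M) (h : field2 M) (psi : field1 P) (eps : R) :
    field2 P :=
  fun q u v => eps^-1 * pullback2 p h q u v + psi q u * psi q v.

(** ** Hamiltonians and Mane critical values *)

Definition dual_norm (R : realType) (n : nat) (M : manifold R n) (g : field2 M)
    (x : M) (a : 'rV[R]_n -> R) : R :=
  sup [set `|a v| | v in [set v | g x v v <= 1]].

Definition has_bounded_primitive (R : realType) (n : nat) (Mt M : manifold R n)
    (pr : Mt -> M) (w : field2 M) : Prop :=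
  exists (k : field2 M) (t : field1 Mt) (C : R),
    [/\ riemannian_metric k, primitive_of (pullback2 pr w) t &
        forall x, dual_norm (pullback2 pr k) x (t x) <= C].

(* a Hamiltonian on T^*M, as a function of a point and a covector at it *)
Definition hamiltonian (R : realType) (n : nat) (M : manifold R n) :=
  M -> ('rV[R]_n -> R) -> R.

Definition kinetic (R : realType) (n : nat) (M : manifold R n) (g : field2 M) :
    hamiltonian M :=
  fun x a => 2^-1 * dual_norm g x a ^+ 2.

(* the lift of H along a covering pr: the covector a at x is transported to
   pr x by the inverse of the tangent map of pr at x *)
Definition lift_hamiltonian (R : realType) (n : nat) (E B : manifold R n)
    (pr : E -> B) (H : hamiltonian B) : hamiltonian E :=
  fun x a => H (pr x) (fun u => a (get [set v | tangent pr x v = u])).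

Definition strict_mane_value (R : realType) (n : nat) (M : manifold R n)
    (H : hamiltonian M) (sigma : field2 M) : \bar R :=
  ereal_inf [set ereal_sup [set (H x (t x))%:E | x in setT]
            | t in primitive_of sigma].

Definition mane_value (R : realType) (n : nat) (E B : manifold R n)
    (pr : E -> B) (H : hamiltonian B) (sigma : field2 B) : \bar R :=
  strict_mane_value (lift_hamiltonian pr H) (pullback2 pr sigma).

(* Main.v *)
From Pilot Require Import Defs.
From HB Require Import structures.
From mathcomp Require Import all_boot all_order all_algebra.
From mathcomp Require Import all_classical all_reals all_analysis.
Import Order.TTheory GRing.Theory Num.Theory.
Import numFieldNormedType.Exports.
From mathcomp Require Import ring lra.
Local Open Scope classical_set_scope.
Local Open Scope ring_scope.

Local Notation coord := Pilot.Defs.coord.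
Set Implicit Arguments.
Unset Strict Implicit.
Unset Printing Implicit Defensive.

(** Write X for the generator of the circle action, so that psi X = 1 and X is a
    unit vector of every metric g_eps.

    Strict value.  The form - psi is a primitive of sigma = - d psi of dual norm
    at most 1, whence c_0 <= 1/2.  Conversely let theta be a primitive with
    H (q, theta_q) < 1/2 everywhere.  Then |theta X| < 1, so that
    tau = theta + psi is a closed form with tau X > 0.  Averaging tau over the
    circle ([average]) gives a closed invariant form, whose value on X is the
    integral of tau over the fibre.  This period is locally constant because tau
    is closed ([period_locally_constant]), hence it is a constant c > 0.  The form
    average / c - psi is then invariant and kills X, so it is the pullback of a
    form on M ([basic_descends]), and this form is a primitive of Omega, against
    the assumption that Omega is not exact ([transverse_closed_form_exact]).

    Value on the universal cover.  The universal cover of P is simply connected,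
    so its projection to M lifts to a map phi into the universal cover of M
    ([exists_smooth_lift]).  The pullback Theta of the bounded primitive of Omega
    by phi is a primitive of sigma.  Any two metrics on the compact manifold M are
    comparable ([metric_comparison]), so |Theta v| is bounded by a constant times
    the h-length of the projection of v to M.  That length is at most the square
    root of eps on the unit ball of g_eps, so that H (Theta) = O(eps)
    ([mane_value_bundle_le]); the values are nonnegative and tend to 0.

    Both halves rest on the compatibility of d with pullbacks, which is proved
    for maps Phi from a normed space to a manifold ([ext1_pull1]).  This one
    statement covers local expressions of maps of manifolds as well as the action
    (r, y) |-> r . y read in a chart, where closedness of tau becomes an exchange
    of the derivatives in r and in y. *)

(** * Differentials and finite systems of coordinates *)
Definition linear_map (R : realType) (E F : normedModType R) (f : E -> F)
    (f_lin : linear f) : {linear E -> F} :=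
  HB.pack f (GRing.isLinear.Build R E F _ f f_lin).

Section Differentials.
Context {R : realType}.
Implicit Types E F G : normedModType R.

Lemma is_diff_eps E F (f : E -> F) (x : E) (L : {linear E -> F}) :
    continuous L ->
    (forall e : R, 0 < e ->
      \forall h \near (0 : E), `|f (h + x) - f x - L h| <= e * `|h|) ->
  differentiable f x /\ ('d f x = L :> (E -> F)).
Proof.
move=> Lc fL.
have fo : f \o shift x = cst (f x) + L +o_ 0 id.
  apply/eqaddoP => e e0; near=> h.
  rewrite [X in `|X|](_ : _ = f (h + x) - f x - L h).
    by near: h; exact: fL.
  by rewrite /= opprD addrA.
have dE := diff_unique Lc fo.
split=> //; apply/diff_locallyP; split; first by rewrite dE.
by rewrite dE.
Unshelve. all: by end_near. Qed.

Lemma diff_eps E F (f : E -> F) (x : E) : differentiable f x ->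
  forall e : R, 0 < e ->
    \forall h \near (0 : E), `|f (h + x) - f x - 'd f x h| <= e * `|h|.
Proof.
move=> /diff_locally /eqaddoP fo e e0; near=> h.
have : `|(f \o shift x - (cst (f x) + 'd f x)) h| <= e * `|id h|.
  by near: h; exact: fo.
by rewrite /= [X in `|X|](_ : _ = f (h + x) - f x - 'd f x h) // /= !fctE opprD addrA.
Unshelve. all: by end_near. Qed.

Lemma near_translate E (x : E) (P : set E) :
  (\forall y \near x, P y) -> \forall h \near (0 : E), P (h + x).
Proof.
move=> Px; have : (h + x) @[h --> (0 : E)] --> 0 + x.
  by apply: cvgD; [exact: cvg_id | exact: cvg_cst].
by rewrite add0r; apply.
Qed.

Lemma near_eq_diff E F (f g : E -> F) (x : E) :
    (\forall y \near x, f y = g y) -> differentiable f x ->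
  differentiable g x /\ ('d g x = 'd f x :> (E -> F)).
Proof.
move=> fg df; apply: is_diff_eps; first exact: diff_continuous.
move=> e e0; have fgx : f x = g x by exact: nbhs_singleton fg.
have {}fg := near_translate fg.
near=> h; rewrite -fgx.
have <- : f (h + x) = g (h + x) by near: h.
by near: h; exact: diff_eps.
Unshelve. all: by end_near. Qed.

(** A space with finitely many coordinates; it is what makes partial derivatives
    control the differential.  The index is any finite type, so that products
    are covered. *)
Definition finite_coords E := exists (I : finType) (e : I -> E)
  (l : I -> {linear E -> R^o}),
  (forall i, continuous (l i)) /\ forall v, v = \sum_i l i v *: e i.

Lemma finite_coords_rV n : finite_coords 'rV[R]_n.
Proof.
have lin (i : 'I_n) : linear (fun v : 'rV[R]_n => v ord0 i : R^o).
  by move=> a u v; rewrite !mxE.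
exists 'I_n, (fun i => delta_mx ord0 i), (fun i => linear_map (lin i)).
split=> [i|v]; first exact: coord_continuous.
by rewrite [LHS]row_sum_delta.
Qed.

Lemma finite_coords_R : finite_coords R^o.
Proof.
exists unit, (fun=> 1), (fun=> idfun); split=> [_|v]; first by move=> x; exact: cvg_id.
by rewrite big_const card_unit /= addr0 /GRing.scale /= mulr1.
Qed.

Lemma finite_coords_prod E F :
  finite_coords E -> finite_coords F -> finite_coords (E * F)%type.
Proof.
move=> [I [e [l [lc le]]]] [J [d [m [mc me]]]].
have lin1 i : linear (fun v : E * F => l i v.1) by move=> a u v /=; rewrite linearP.
have lin2 i : linear (fun v : E * F => m i v.2) by move=> a u v /=; rewrite linearP.
exists (I + J)%type, (fun k => match k with inl i => (e i, 0) | inr j => (0, d j) end),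
  (fun k => match k with inl i => linear_map (lin1 i) | inr j => linear_map (lin2 j) end).
split=> [[i|j]|[v w]].
- move=> z; apply: (@continuous_comp _ _ _ fst (l i)); [exact: cvg_fst|exact: lc].
- move=> z; apply: (@continuous_comp _ _ _ snd (m j)); [exact: cvg_snd|exact: mc].
- rewrite big_sumType /=.
  have -> : \sum_i l i v *: ((e i, 0) : E * F) = (v, 0).
    rewrite [in RHS](le v).
    apply: (big_ind2 (fun (x : E*F) y => x = (y, 0))) => //.
      by move=> _ y1 _ y2 -> ->; congr pair; rewrite /= addr0.
    by move=> i _; congr pair; rewrite /= scaler0.
  have -> : \sum_i m i w *: ((0, d i) : E * F) = (0, w).
    rewrite [in RHS](me w).
    apply: (big_ind2 (fun (x : E*F) y => x = (0, y))) => //.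
      by move=> _ y1 _ y2 -> ->; congr pair; rewrite /= addr0.
    by move=> i _; congr pair; rewrite /= scaler0.
  by congr pair; rewrite /= ?addr0 ?add0r.
Qed.

Lemma linear_continuous_coords E F (L : {linear E -> F}) :
  finite_coords E -> continuous L.
Proof.
move=> [I [e [l [lc le]]]] x.
rewrite (_ : L = (fun v => \sum_i l i v *: L (e i)) :> (E -> F)); last first.
  by apply/funext => v; rewrite {1}(le v) linear_sum; apply: eq_bigr => i _; rewrite linearZ.
apply: cvg_big => [|i _]; [exact: add_continuous | apply: cvgZr_tmp; exact: lc].
Qed.

End Differentials.

(** * Stability properties of C^k and smooth maps *)
Section Smoothness.
Context {R : realType}.
Implicit Types E F G : normedModType R.

Lemma Ck_sub E F k (U V : set E) (f : E -> F) :
  V `<=` U -> Ck k U f -> Ck k V f.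
Proof.
move=> VU; elim: k f => [|k IH] f /= fU; first by move=> x /VU; exact: fU.
by split=> [x /VU|v]; [exact: fU.1|apply: IH; exact: fU.2].
Qed.

Lemma Ck_pred E F k (U : set E) (f : E -> F) : Ck k.+1 U f -> Ck k U f.
Proof.
elim: k f => [|k IH] f [df Df].
  by move=> x Ux; apply: differentiable_continuous; exact: df.
by split=> // v; apply: IH; exact: Df.
Qed.

Lemma Ck_ext E F k (U : set E) (f g : E -> F) : open U ->
  (forall x, U x -> f x = g x) -> Ck k U f -> Ck k U g.
Proof.
move=> oU; elim: k f g => [|k IH] f g fg /= fU.
  move=> x Ux; have near_fg : {near x, f =1 g}.
    by near=> y; apply: fg; near: y; exact: open_nbhs_nbhs.
  rewrite /prop_for /continuous_at -(fg x Ux).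
  apply: cvg_trans (fU x Ux); apply: near_eq_cvg.
  by near=> y; near: y; exact: near_fg.
have near_fg x : U x -> {near x, f =1 g}.
  by move=> Ux; near=> y; apply: fg; near: y; exact: open_nbhs_nbhs.
split=> [x Ux|v]; first by apply: (near_eq_diff (near_fg x Ux) (fU.1 x Ux)).1.
by apply: IH (fU.2 v) => x Ux; apply: near_eq_derive; exact: near_fg.
Unshelve. all: by end_near. Qed.

Lemma Ck_cst E F k (U : set E) (a : F) : Ck k U (fun=> a).
Proof.
elim: k a => [|k IH] a /=; first by move=> x _; exact: cvg_cst.
split=> [x _|v]; first exact: differentiable_cst.
rewrite (_ : 'D_v _ = fun=> 0); first exact: IH.
by apply/funext => x; exact: derive_cst.
Qed.

Lemma Ck_linear E F k (U : set E) (L : {linear E -> F}) :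
  continuous L -> Ck k U L.
Proof.
move=> Lc; case: k => [|k] /=; first by move=> x _; exact: Lc.
split=> [x _|v]; first exact: linear_differentiable.
rewrite (_ : 'D_v _ = fun=> L v); first exact: Ck_cst.
by apply/funext => x; rewrite deriveE ?diff_lin//; exact: linear_differentiable.
Qed.

Lemma Ck_linear_comp E F G k (U : set E) (L : {linear F -> G}) (f : E -> F) :
  open U -> continuous L -> Ck k U f -> Ck k U (L \o f).
Proof.
move=> oU Lc; elim: k f => [|k IH] f /= fU.
  by move=> x Ux; apply: continuous_comp; [exact: fU|exact: Lc].
split=> [x Ux|v].
  by apply: differentiable_comp; [exact: fU.1|exact: linear_differentiable].
apply: Ck_ext (IH _ (fU.2 v)) => // x Ux /=.
have dL : differentiable L (f x) by exact: linear_differentiable.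
rewrite !deriveE//; [|exact: differentiable_comp (fU.1 x Ux) dL|exact: fU.1].
by rewrite (diff_comp (fU.1 x Ux) dL) /= diff_lin.
Qed.

Lemma CkD E F k (U : set E) (f g : E -> F) : open U ->
  Ck k U f -> Ck k U g -> Ck k U (fun x => f x + g x).
Proof.
move=> oU; elim: k f g => [|k IH] f g /= fU gU.
  by move=> x Ux; apply: continuousD; [exact: fU|exact: gU].
split=> [x Ux|v].
  by apply: differentiableD; [exact: fU.1|exact: gU.1].
apply: Ck_ext (IH _ _ (fU.2 v) (gU.2 v)) => // x Ux /=.
by rewrite deriveD//; apply: diff_derivable; [exact: fU.1|exact: gU.1].
Qed.

Lemma Ck_sum E F k (U : set E) (I : Type) (r : seq I) (f : I -> E -> F) :
  open U -> (forall i, Ck k U (f i)) -> Ck k U (fun x => \sum_(i <- r) f i x).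
Proof.
move=> oU fU; elim: r => [|i r IH].
  apply: Ck_ext (Ck_cst k U 0) => // x _; by rewrite big_nil.
by apply: Ck_ext (CkD oU (fU i) IH) => // x _; rewrite big_cons.
Qed.

Lemma CkM E k (U : set E) (f g : E -> R^o) : open U ->
  Ck k U f -> Ck k U g -> Ck k U (fun x => f x * g x : R^o).
Proof.
move=> oU; elim: k f g => [|k IH] f g fU gU.
  by move=> x Ux; apply: continuousM; [exact: fU|exact: gU].
split=> [x Ux|v].
  by apply: differentiableM; [exact: fU.1|exact: gU.1].
have := CkD oU (IH _ _ (Ck_pred fU) (gU.2 v)) (IH _ _ (Ck_pred gU) (fU.2 v)).
apply: Ck_ext => // x Ux /=.
by rewrite deriveM//; apply: diff_derivable; [exact: fU.1|exact: gU.1].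
Qed.

(** In coordinates the chain rule writes a derivative of g o f as a sum of products
    of a derivative of f and a partial derivative of g composed with f, to which
    the induction on k applies. *)
Lemma Ck_comp_real E F k (U : set E) (V : set F) (f : E -> F) (g : F -> R^o) :
  finite_coords F -> open U -> open V -> (forall x, U x -> V (f x)) ->
  Ck k U f -> Ck k V g -> Ck k U (g \o f).
Proof.
move=> [I [e [l [lc le]]]] oU oV UV.
elim: k f g UV => [|k IH] f g UV fU gV.
  by move=> x Ux; apply: continuous_comp; [exact: fU|apply: gV; exact: UV].
split=> [x Ux|v].
  by apply: differentiable_comp; [exact: fU.1|apply: gV.1; exact: UV].
have : Ck k U (fun x => \sum_(i <- index_enum I)
    ((l i \o 'D_v f) x * ('D_(e i) g \o f) x : R^o)).
  apply: Ck_sum => // i; apply: CkM => //.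
    by apply: Ck_linear_comp => //; exact: fU.2.
  by apply: IH => //; [exact: Ck_pred|exact: gV.2].
apply: Ck_ext => // x Ux /=.
have df := fU.1 x Ux; have dg := gV.1 _ (UV x Ux).
rewrite [RHS]deriveE; last exact: differentiable_comp.
rewrite diff_comp//= -[in RHS](deriveE _ df) [X in 'd g _ X](le ('D_v f x)).
by rewrite linear_sum; apply: eq_bigr => i _; rewrite linearZ/= (deriveE _ dg).
Qed.

Lemma Ck_coords E F k (U : set E) (f : E -> F) : open U ->
  finite_coords F ->
  (forall l : {linear F -> R^o}, continuous l -> Ck k U (l \o f)) -> Ck k U f.
Proof.
move=> oU [I [e [l [lc le]]]] lf.
have lin (a : F) : linear (fun c : R^o => c *: a).
  by move=> c u v; rewrite scalerDl scalerA.
have : Ck k U (fun x => \sum_(i <- index_enum I)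
   (linear_map (lin (e i)) \o (l i \o f)) x).
  apply: Ck_sum => // i; apply: Ck_linear_comp => //; last exact: lf.
  by move=> x; apply: cvgZr_tmp; exact: cvg_id.
by apply: Ck_ext => // x _ /=; rewrite [RHS]le.
Qed.

Lemma Ck_comp E F G k (U : set E) (V : set F) (f : E -> F) (g : F -> G) :
  finite_coords F -> finite_coords G ->
  open U -> open V -> (forall x, U x -> V (f x)) ->
  Ck k U f -> Ck k V g -> Ck k U (g \o f).
Proof.
move=> fcF fcG oU oV UV fU gV; apply: Ck_coords => // l lc.
apply: (@Ck_comp_real _ _ k U V f (l \o g)) => //.
exact: Ck_linear_comp.
Qed.

Lemma smooth_at_continuous E F (f : E -> F) x :
  smooth_at f x -> {for x, continuous f}.
Proof. by move=> [U [oU Ux] /(_ 0%N) fU]; exact: fU. Qed.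

Lemma smooth_at_diff E F (f : E -> F) x : smooth_at f x -> differentiable f x.
Proof. by move=> [U [oU Ux] /(_ 1%N) [fU _]]; exact: fU. Qed.

Lemma near_smooth_at E F (f : E -> F) x :
  smooth_at f x -> \forall y \near x, smooth_at f y.
Proof.
move=> [U [oU Ux] fU]; near=> y; exists U => //; split=> //.
by near: y; exact: open_nbhs_nbhs.
Unshelve. all: by end_near. Qed.

Lemma near_eq_smooth E F (f g : E -> F) x :
  (\forall y \near x, f y = g y) -> smooth_at f x -> smooth_at g x.
Proof.
rewrite -nbhs_nearE nbhsE => -[V [oV Vx] fg] [U [oU Ux] fU].
exists (U `&` V); first by split; [exact: openI|].
move=> k; apply: (@Ck_ext _ _ k _ f); first exact: openI.
  by move=> y [_ /fg].
by apply: Ck_sub (fU k) => y [].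
Qed.

Lemma smooth_at_derive E F (f : E -> F) x v :
  smooth_at f x -> smooth_at ('D_v f) x.
Proof. by move=> [U oU fU]; exists U => // k; exact: (fU k.+1).2. Qed.

Lemma smooth_at_cst E F (a : F) x : smooth_at (fun=> a : F) (x : E).
Proof.
exists setT; first by split=> //; exact: openT.
by move=> k; exact: Ck_cst.
Qed.

Lemma smooth_at_linear E F (L : {linear E -> F}) x :
  continuous L -> smooth_at L x.
Proof.
move=> Lc; exists setT; first by split=> //; exact: openT.
by move=> k; exact: Ck_linear.
Qed.

Lemma smooth_atD E F (f g : E -> F) x :
  smooth_at f x -> smooth_at g x -> smooth_at (fun y => f y + g y) x.
Proof.
move=> [U [oU Ux] fU] [V [oV Vx] gV]; have oUV := openI oU oV.
exists (U `&` V) => // k; apply: CkD => //.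
  by apply: Ck_sub (fU k) => y [].
by apply: Ck_sub (gV k) => y [].
Qed.

Lemma smooth_at_sum E F (I : Type) (r : seq I) (f : I -> E -> F) x :
  (forall i, smooth_at (f i) x) ->
  smooth_at (fun y => \sum_(i <- r) f i y) x.
Proof.
move=> fx; elim: r => [|i r IH].
  apply: near_eq_smooth (smooth_at_cst _ _).
  by near=> y; rewrite big_nil.
apply: near_eq_smooth (smooth_atD (fx i) IH).
by near=> y; rewrite big_cons.
Unshelve. all: by end_near. Qed.

Lemma smooth_atM E (f g : E -> R^o) x :
  smooth_at f x -> smooth_at g x -> smooth_at (fun y => f y * g y : R^o) x.
Proof.
move=> [U [oU Ux] fU] [V [oV Vx] gV]; have oUV := openI oU oV.
exists (U `&` V) => // k; apply: CkM => //.
  by apply: Ck_sub (fU k) => y [].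
by apply: Ck_sub (gV k) => y [].
Qed.

Lemma smooth_at_comp E F G (f : E -> F) (g : F -> G) x :
  finite_coords F -> finite_coords G ->
  smooth_at f x -> smooth_at g (f x) -> smooth_at (g \o f) x.
Proof.
move=> fcF fcG fx [V [oV Vx] gV].
have /near_smooth_at sx := fx; have := smooth_at_continuous fx.
move=> /(_ V (open_nbhs_nbhs (conj oV Vx))) fV.
have [W [oW Wx] WfV] : exists2 W, open_nbhs x W & W `<=` f @^-1` V.
  by move: fV; rewrite /= /nbhs/= -/(nbhs x (f @^-1` V)) nbhsE.
have [U [oU Ux] fU] := fx.
have oUW := openI oU oW; exists (U `&` W) => // k.
apply: (@Ck_comp _ _ _ k _ V) => //; first by move=> y [_ /WfV].
by apply: Ck_sub (fU k) => y [].
Qed.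

Lemma smooth_at_linear_comp E F G (L : {linear F -> G}) (f : E -> F) x :
  continuous L -> smooth_at f x -> smooth_at (L \o f) x.
Proof.
move=> Lc [U [oU Ux] fU]; exists U => // k; exact: Ck_linear_comp.
Qed.

Lemma smooth_at_coords E F (f : E -> F) x : finite_coords F ->
  (forall l : {linear F -> R^o}, continuous l -> smooth_at (l \o f) x) ->
  smooth_at f x.
Proof.
move=> [I [e [l [lc le]]]] lf.
have lin (a : F) : linear (fun c : R^o => c *: a).
  by move=> c u v; rewrite scalerDl scalerA.
apply: near_eq_smooth (smooth_at_sum (index_enum I)
   (f := fun i => linear_map (lin (e i)) \o (l i \o f)) _).
  by near=> y; rewrite /= [RHS]le.
move=> i; apply: smooth_at_linear_comp; last exact: lf.
by move=> y; apply: cvgZr_tmp; exact: cvg_id.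
Unshelve. all: by end_near. Qed.

Lemma smooth_at_pair E F G (f : E -> F) (g : E -> G) x :
  finite_coords F -> finite_coords G ->
  smooth_at f x -> smooth_at g x -> smooth_at (fun y => (f y, g y)) x.
Proof.
move=> fcF fcG fx gx; apply: smooth_at_coords; first exact: finite_coords_prod.
move=> l lc.
have lin1 : linear (fun u : F => l (u, 0)).
  move=> a u v; rewrite -linearP; congr (l _); congr pair => //=.
  by rewrite scaler0 addr0.
have lin2 : linear (fun u : G => l (0, u)).
  move=> a u v; rewrite -linearP; congr (l _); congr pair => //=.
  by rewrite scaler0 addr0.
apply: near_eq_smooth (smooth_atD
   (smooth_at_linear_comp (L := linear_map lin1) _ fx)
   (smooth_at_linear_comp (L := linear_map lin2) _ gx)).
- near=> y => /=; rewrite -linearD; congr (l _); congr pair => /=.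
    by rewrite addr0.
  by rewrite add0r.
- exact: linear_continuous_coords.
- exact: linear_continuous_coords.
Unshelve. all: by end_near. Qed.

End Smoothness.

(** * Mean value theorem and symmetry of second derivatives *)
Section MeanValue.
Context {R : realType}.
Implicit Types E F G : normedModType R.

Lemma is_derive_line E F (f : E -> F) (x h : E) (t : R) :
  differentiable f (t *: h + x) ->
  is_derive (t : R^o) (1 : R^o) (fun s : R^o => f (s *: h + x))
    ('D_h f (t *: h + x)).
Proof.
move=> df; pose A := fun s : R^o => s *: h + x.
have lin : linear (fun s : R^o => s *: h : E).
  by move=> c u v; rewrite scalerDl scalerA.
have linc : continuous (linear_map lin).
  by move=> y; apply: cvgZr_tmp; exact: cvg_id.
have Aeps (e : R) : 0 < e -> \forall k \near (0 : R^o),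
    `|A (k + t) - A t - linear_map lin k| <= e * `|k|.
  move=> e0; near=> k.
  rewrite /A /= scalerDl opprD addrACA subrr addr0 addrK subrr normr0.
  by rewrite mulr_ge0// ltW.
have [dA' dAE] := is_diff_eps linc Aeps.
have dfA : differentiable (f \o A) (t : R^o).
  exact: differentiable_comp.
apply: DeriveDef; first exact: diff_derivable dfA.
rewrite (deriveE _ dfA) (deriveE _ df) (diff_comp dA' df) /=.
by rewrite dAE /= scale1r.
Unshelve. all: by end_near. Qed.

Lemma mean_value E (f : E -> R^o) (x h : E) :
  (forall t : R, 0 <= t <= 1 -> differentiable f (t *: h + x)) ->
  exists2 t : R, 0 <= t <= 1 & f (h + x) - f x = 'D_h f (t *: h + x).
Proof.
move=> df; have df' t : 0 <= t <= 1 -> _ := fun H => is_derive_line (df t H).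
have [] := @MVT R (fun s => f (s *: h + x)) (fun t => 'D_h f (t *: h + x)) 0 1 ltr01.
- by move=> t; rewrite in_itv /= => /andP[t0 t1]; apply: df'; rewrite !ltW.
- apply: derivable_within_continuous => t; rewrite in_itv /= => t01.
  by have [] := df' t t01.
- move=> t; rewrite in_itv /= => /andP[t0 t1]; rewrite scale1r scale0r add0r subr0 mulr1 => ->.
  by exists t; rewrite ?ltW.
Qed.

(** The mean value theorem is applied once, in the direction u, to the increment
    of f along s v; the differential of 'D_u f at x then gives the second order
    term.  The left-hand side without its last term is symmetric in u and v, which
    is why the two mixed derivatives agree. *)
Lemma second_difference E (f : E -> R^o) (x u v : E) :
    (\forall y \near x, differentiable f y) ->
    differentiable ('D_u f : E -> R^o) x ->
  forall e : R, 0 < e -> \forall s \near (0 : R)^'+,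
    `|f (s *: u + (s *: v + x)) - f (s *: u + x) - f (s *: v + x) + f x
      - s ^+ 2 * 'D_v ('D_u f) x| <= e * s ^+ 2.
Proof.
move=> df dDf e e0.
(* two vectors of length at most s (|u| + |v|) enter, each with the factor e / C *)
pose C := 2 * (`|u| + `|v|) + 1.
have C0 : 0 < C by rewrite /C ltr_wpDl// mulr_ge0// addr_ge0.
have eC : 0 < e / C by exact: divr_gt0.
have /nbhs_ballP[d1 d10 D1] : nbhs (0 : E) [set h | differentiable f (h + x)].
  exact: near_translate df.
have /nbhs_ballP[d2 d20 D2] := diff_eps dDf eC.
near=> s.
have s0 : 0 < s by near: s; exact: nbhs_right_gt.
have small (w : E) : `|w| <= s * (`|u| + `|v|) -> ball 0 d1 w /\ ball 0 d2 w.
  move=> ws; have wd : `|w| < Num.min d1 d2.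
    apply: le_lt_trans ws _.
    apply: (@le_lt_trans _ _ (s * C)).
      by rewrite ler_pM2l// /C; have := normr_ge0 u; have := normr_ge0 v; lra.
    rewrite -ltr_pdivlMr//; near: s; apply: nbhs_right_lt.
    by rewrite divr_gt0// lt_min; apply/andP.
  by move: wd; rewrite lt_min -!ball_normE /ball_ /= sub0r normrN => /andP.
have bnd r (w : E) : 0 <= r <= s -> `|w| <= s * `|v| -> `|r *: u + w| <= s * (`|u| + `|v|).
  move=> /andP[r0 rs] ws; rewrite (le_trans (ler_normD _ _))// mulrDr lerD//.
  by rewrite normrZ ger0_norm// ler_wpM2r.
have bv : `|s *: v| <= s * `|v| by rewrite normrZ gtr0_norm.
have b0 : `|0 : E| <= s * `|v| by rewrite normr0 mulr_ge0// ltW.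
pose phi (r : R^o) : R^o := f (r *: u + (s *: v + x)) - f (r *: u + x).
have dphi (r : R^o) : 0 <= r <= s ->
    is_derive r (1 : R^o) phi ('D_u f (r *: u + (s *: v + x)) - 'D_u f (r *: u + x)).
  move=> rs; apply: is_deriveB; apply: is_derive_line.
    by have := D1 _ (small _ (bnd r _ rs bv)).1; rewrite addrA.
  by have := D1 _ (small _ (bnd r _ rs b0)).1; rewrite addr0.
have [c cs phiE] : exists2 c, c \in `]0, s[ & phi s - phi 0 =
    ('D_u f (c *: u + (s *: v + x)) - 'D_u f (c *: u + x)) * (s - 0).
  apply: (@MVT R phi (fun r => 'D_u f (r *: u + (s *: v + x)) - 'D_u f (r *: u + x))) => //.
    by move=> r; rewrite in_itv /= => /andP[r0 rs]; apply: dphi; rewrite !ltW.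
  apply: derivable_within_continuous => r; rewrite in_itv /= => rs.
  by have [] := dphi r rs.
have {}cs : 0 <= c <= s by move: cs; rewrite in_itv /= => /andP[c0 c1]; rewrite !ltW.
have -> : f (s *: u + (s *: v + x)) - f (s *: u + x) - f (s *: v + x) + f x
    = phi s - phi 0 by rewrite /phi !scale0r !add0r; ring.
have L1 := D2 _ (small _ (bnd c _ cs bv)).2.
have L2 := D2 _ (small _ (bnd c _ cs b0)).2.
have n1 := bnd c _ cs bv; have n2 := bnd c _ cs b0.
rewrite phiE subr0 [X in _ - X](_ : _ = s * ('d ('D_u f) x (s *: v))); last first.
  by rewrite linearZ /= (deriveE _ dDf) /GRing.scale /= mulrA -expr2.
rewrite -[X in `|X - _|]mulrC -mulrBr normrM gtr0_norm//.
rewrite (_ : e * s ^+ 2 = s * (e * s)) ?ler_pM2l//; last by ring.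
have -> : 'd ('D_u f) x (s *: v) =
   'd ('D_u f) x (c *: u + s *: v) - 'd ('D_u f) x (c *: u + 0).
  by rewrite addr0 linearD addrC addKr.
set d1' := 'd _ _ (c *: u + s *: v) in L1 *; set d2' := 'd _ _ (c *: u + 0) in L2 *.
rewrite addr0 in L2; rewrite -(addrA (c *: u)) in L1.
set a1 := derive _ _ _ in L1 *; set a2 := derive f (c *: u + x) u in L2 *.
set a0 := derive f x u in L1 L2.
have -> : a1 - a2 - (d1' - d2') = (a1 - a0 - d1') - (a2 - a0 - d2') by ring.
rewrite (le_trans (ler_normB _ _))// (le_trans (lerD L1 L2))//.
rewrite -mulrDr; apply: (@le_trans _ _ (e / C * (s * (2 * (`|u| + `|v|))))).
  rewrite ler_pM2l// mulrCA; rewrite addr0 in n2.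
  move: n1 n2; set w1 := `|_ + _|; set w2 := `|c *: u|; set m := s * _.
  by move=> n1 n2; lra.
have -> : e / C * (s * (2 * (`|u| + `|v|))) = e * (s * (2 * (`|u| + `|v|) / C)).
  by ring.
rewrite ler_pM2l// ger_pMr// ler_pdivrMr// mul1r /C; lra.
Unshelve. all: by end_near. Qed.

Lemma derive_commute E (f : E -> R^o) (x u v : E) :
  smooth_at f x -> 'D_v ('D_u f) x = 'D_u ('D_v f) x.
Proof.
move=> fx.
have df : \forall y \near x, differentiable f y.
  by near=> y; apply: smooth_at_diff; near: y; exact: near_smooth_at.
have du : differentiable ('D_u f : E -> R^o) x.
  by apply: smooth_at_diff; exact: smooth_at_derive.
have dv : differentiable ('D_v f : E -> R^o) x.
  by apply: smooth_at_diff; exact: smooth_at_derive.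
apply/eqP; rewrite -subr_eq0 -normr_le0; apply/ler_addgt0Pl => e e0.
have e2 : 0 < e / 2 by exact: divr_gt0.
have [s [s0 H1 H2]] : exists s : R, [/\ 0 < s,
    `|f (s *: u + (s *: v + x)) - f (s *: u + x) - f (s *: v + x) + f x
      - s ^+ 2 * 'D_v ('D_u f) x| <= e / 2 * s ^+ 2 &
    `|f (s *: v + (s *: u + x)) - f (s *: v + x) - f (s *: u + x) + f x
      - s ^+ 2 * 'D_u ('D_v f) x| <= e / 2 * s ^+ 2].
  have /filter_ex[s [s0 [H1 H2]]] : \forall s \near (0 : R)^'+, 0 < s /\
    (`|f (s *: u + (s *: v + x)) - f (s *: u + x) - f (s *: v + x) + f x
      - s ^+ 2 * 'D_v ('D_u f) x| <= e / 2 * s ^+ 2 /\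
    `|f (s *: v + (s *: u + x)) - f (s *: v + x) - f (s *: u + x) + f x
      - s ^+ 2 * 'D_u ('D_v f) x| <= e / 2 * s ^+ 2).
    apply: filterI; first exact: nbhs_right_gt.
    by apply: filterI; exact: second_difference.
  by exists s; split; [exact: s0|exact: H1|exact: H2].
have s2 : 0 < s ^+ 2 by rewrite exprn_gt0.
rewrite addr0 -(ler_pM2l s2) -[X in X * `|_|]gtr0_norm// -normrM.
rewrite addrCA in H2.
set a := f _ in H1 H2; set b := f (_ + x) in H1 H2; set c := f (_ + x) in H1 H2.
set p := derive _ _ _ in H1 *; set q := derive _ _ _ in H2 *.
have -> : s ^+ 2 * (p - q) =
   (a - c - b + f x - s ^+ 2 * q) - (a - b - c + f x - s ^+ 2 * p) by ring.
rewrite (le_trans (ler_normB _ _))// (le_trans (lerD H2 H1))//.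
by rewrite mulrC -mulrDr -splitr.
Unshelve. all: by end_near. Qed.

End MeanValue.

(** * Mean of a function over the unit interval *)
Section Mean.
Context {R : realType}.
Implicit Types (f g F : R -> R).
Local Notation mu := (@lebesgue_measure R).

(** The lower bound a of the domain is arbitrary: [mean_shift] needs an
    antiderivative that reaches to the left of the shift. *)
Lemma antiderivative f (a : R) : continuous f ->
  exists F : R -> R, forall x : R, a < x -> is_derive x 1 F (f x).
Proof.
move=> fc.
have fi u : mu.-integrable `[a, u] (EFin \o f).
  apply: continuous_compact_integrable; first exact: segment_compact.
  by apply: continuous_subspaceT.
exists (fun x => \int[mu]_(t in [set` `[a, x]]) (f t)) => x ax.
have xu : x < x + 1 by rewrite ltrDl.
have [dF <-] := continuous_FTC1_closed xu (fi _) ax (fc x).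
by rewrite derive1E; exact: derivableP.
Qed.

(** The integral over [0, 1], through an antiderivative: every property below is
    then an instance of the mean value theorem. *)
Definition mean f : R :=
  let F := get [set F : R -> R | forall x : R, -1 < x -> is_derive x 1 F (f x)] in
  F 1 - F 0.

Lemma mean_spec f : continuous f -> exists F : R -> R,
  (forall x : R, -1 < x -> is_derive x 1 F (f x)) /\ mean f = F 1 - F 0.
Proof.
move=> /(@antiderivative f (-1)) fE.
have := getPex fE; rewrite /mean; set F := get _ => HF.
by exists F.
Qed.

Lemma increment f F (a b : R) : a <= b ->
  (forall x : R, a <= x <= b -> is_derive x 1 F (f x)) ->
  exists2 c, a <= c <= b & F b - F a = f c * (b - a).
Proof.
move=> ab dF; have [] := @MVT_segment R F f a b ab.
- by move=> x; rewrite in_itv /= => /andP[ax xb]; apply: dF; rewrite !ltW.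
- apply: derivable_within_continuous => x; rewrite in_itv /= => axb.
  by have [] := dF x axb.
- by move=> c; rewrite in_itv /= => cab FE; exists c.
Qed.

Lemma mean_increment f : continuous f -> exists2 c, 0 <= c <= 1 & mean f = f c.
Proof.
move=> /mean_spec[F [dF ->]].
have [x /andP[x0 _]|c c01 ->] := @increment f F 0 1 ler01.
  by apply: dF; apply: lt_le_trans x0; rewrite ltrN10.
by exists c; rewrite // subr0 mulr1.
Qed.

Lemma mean_antiderivative f F : continuous f ->
  (forall x : R, 0 <= x <= 1 -> is_derive x 1 F (f x)) ->
  mean f = F 1 - F 0.
Proof.
move=> /mean_spec[G [dG ->]] dF.
have dGF (x : R) : 0 <= x <= 1 -> is_derive x 1 (G - F) ((fun=> 0) x).
  move=> x01; rewrite -(subrr (f x)); apply: is_deriveB; last exact: dF.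
  by apply: dG; apply: lt_le_trans (andP x01).1; rewrite ltrN10.
have [c _ GF] := increment ler01 dGF.
have {GF} : G 1 - F 1 - (G 0 - F 0) = 0 by rewrite -[LHS]/((G - F) 1 - (G - F) 0) GF mul0r.
by move=> GF; lra.
Qed.

Lemma mean_linear (a : R) f g : continuous f -> continuous g ->
  mean (fun x => a * f x + g x) = a * mean f + mean g.
Proof.
move=> fc gc; have [F [dF ->]] := mean_spec fc; have [G [dG ->]] := mean_spec gc.
have -> : mean (fun x => a * f x + g x) = (a *: F + G) 1 - (a *: F + G) 0.
  apply: mean_antiderivative.
    move=> x; apply: cvgD; last exact: gc.
    by apply: cvgM; [exact: cvg_cst|exact: fc].
  move=> x /andP[x0 _]; have x1 : -1 < x by apply: lt_le_trans x0; rewrite ltrN10.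
  have := dF x x1; have := dG x x1 => dGx dFx.
  exact: is_deriveD.
by rewrite !fctE /GRing.scale /=; ring.
Qed.

Lemma mean_norm_le f (c : R) : continuous f ->
  (forall x, 0 <= x <= 1 -> `|f x| <= c) -> `|mean f| <= c.
Proof. by move=> /mean_increment[x x01 ->]; exact. Qed.

Lemma mean_gt0 f : continuous f -> (forall x, 0 < f x) -> 0 < mean f.
Proof. by move=> /mean_increment[x x01 ->]; exact. Qed.

(** The derivative of the mean with respect to the shift s is f (1 + s) - f s. *)
Lemma mean_shift f (t : R) : continuous f -> (forall x, f (1 + x) = f x) ->
  mean (fun x => f (x + t)) = mean f.
Proof.
move=> fc fper.
have [F dF] := antiderivative (Num.min 0 t - 1) fc.
have dF' (x : R) : Num.min 0 t <= x -> is_derive x 1 F (f x).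
  by move=> xt; apply: dF; apply: lt_le_trans xt; rewrite ltrBlDr ltrDl.
have shift (s x : R) : Num.min 0 t <= x + s ->
    is_derive x 1 (fun y => F (y + s)) (f (x + s)).
  move=> xs; rewrite -[f _]mulr1.
  apply: (@is_derive1_comp _ F (fun y : R => y + s)); first exact: dF'.
  exact: is_derive_shift.
have -> : mean f = F 1 - F 0.
  apply: mean_antiderivative => // x /andP[x0 _].
  by apply: dF'; rewrite ge_min x0.
have -> : mean (fun x => f (x + t)) = F (1 + t) - F (0 + t).
  apply: (@mean_antiderivative _ (fun y => F (y + t))).
    move=> x; apply: continuous_comp; last exact: fc.
    by apply: cvgD; [exact: cvg_id|exact: cvg_cst].
  by move=> x /andP[x0 _]; apply: shift; rewrite ge_min lerDr x0 orbT.
pose D s := F (1 + s) - F s.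
have dD (s : R) : Num.min 0 t <= s -> is_derive s 1 D ((fun=> 0) s).
  move=> ts; rewrite -[(fun=> 0) s](subrr (f s)) -{1}(fper s) [1 + s]addrC.
  apply: is_deriveB; last exact: dF'.
  rewrite (_ : (fun s => F (1 + s)) = (fun y => F (y + 1))); last by apply/funext => y; rewrite addrC.
  by apply: shift; rewrite (le_trans ts)// lerDl.
rewrite add0r -[LHS]/(D t).
have -> : F 1 - F 0 = D 0 by rewrite /D addr0.
have [t0|t0] := leP 0 t.
  have [|c _] := @increment (fun=> 0) D 0 t t0.
    by move=> x /andP[x0 _]; apply: dD; rewrite ge_min x0.
  by rewrite mul0r => /eqP; rewrite subr_eq0 => /eqP.
have [|c _] := @increment (fun=> 0) D t 0 (ltW t0).
  by move=> x /andP[x0 _]; apply: dD; rewrite ge_min x0 orbT.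
by rewrite mul0r => /eqP; rewrite subr_eq0 => /eqP.
Qed.

End Mean.

Lemma continuous_pair (T U V : topologicalType) (f : T -> U) (g : T -> V) (x : T) :
  {for x, continuous f} -> {for x, continuous g} ->
  {for x, continuous (fun y => (f y, g y))}.
Proof. by move=> fx gx; exact: (cvg_pair fx gx). Qed.

(** * Differentiation under the mean *)
Section ParametricMean.
Context {R : realType} {E : normedModType R}.
Hypothesis E_coords : finite_coords E.
Implicit Types (f : (R^o * E)%type -> R^o) (W : set E).

Lemma Ck_local (F G : normedModType R) k (U : set F) (f : F -> G) :
  (forall x, U x -> exists2 V, open_nbhs x V & Ck k V f) -> Ck k U f.
Proof.
elim: k f => [|k IH] f fU.
  by move=> x /fU[V [oV Vx] fV]; exact: fV.
split=> [x /fU[V [oV Vx] [df _]]|v]; first exact: df.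
apply: IH => x /fU[V oV [_ Df]]; exists V; [exact: oV|exact: Df].
Qed.

Lemma smooth_on_Ck (F G : normedModType R) (U : set F) (f : F -> G) :
  (forall x, U x -> smooth_at f x) -> forall k, Ck k U f.
Proof. by move=> fU k; apply: Ck_local => x /fU[V oV fV]; exists V. Qed.

(** Tube lemma for the segment [0, 1]. *)
Lemma near_segment (T : topologicalType) (y : T) (Q : R -> T -> Prop) :
  (forall r : R, 0 <= r <= 1 -> \forall r' \near r & z \near y, Q r' z) ->
  \forall z \near y, forall r : R, 0 <= r <= 1 -> Q r z.
Proof.
move=> Qr; have /compact_near_coveringP := @segment_compact R 0 1.
move=> /(_ T (nbhs y) (fun z r => Q r z) _) cover.
have : \forall z \near y, `[0, 1] `<=` (fun r => Q r z).
  by apply: cover => r /=; rewrite in_itv /=; exact: Qr.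
by apply: filterS => z + r r01; apply; rewrite /= in_itv.
Qed.

Lemma continuous_slice f W y : (forall z, W z.2 -> {for z, continuous f}) ->
  W y -> continuous (fun r : R => f (r, y) : R).
Proof.
move=> fc Wy r; apply: (@continuous_comp _ _ _ (fun r : R => (r : R^o, y)) f).
  by apply: continuous_pair; [exact: cvg_id|exact: cvg_cst].
exact: fc.
Qed.

Lemma Ck0_mean f W : open W -> (forall z, W z.2 -> {for z, continuous f}) ->
  forall y, W y -> {for y, continuous (fun y => mean (fun r => f (r, y)) : R^o)}.
Proof.
move=> oW fc y Wy; apply/cvgrPdist_le => e e0.
have Wn : \forall z \near y, W z by exact: open_nbhs_nbhs.
have fn : \forall z \near y, forall r : R, 0 <= r <= 1 ->
    `|f (r, y) - f (r, z)| <= e.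
  apply: near_segment => r r01.
  have fry := fc (r : R^o, y) Wy; have e2 : 0 < e / 2 by exact: divr_gt0.
  have f1 : \forall r' \near r & z \near y, `|f (r, y) - f (r', z)| <= e / 2.
    by have /cvgrPdist_le /(_ _ e2) := fry; apply: filterS => -[].
  have f2 : \forall r' \near r, `|f (r, y) - f (r', y)| <= e / 2.
    have /cvgrPdist_le /(_ _ e2) := @continuous_slice f W y fc Wy r.
    exact.
  have {}f2 : \forall r' \near r & z \near y, `|f (r, y) - f (r', y)| <= e / 2.
    by apply: (@cvg_fst _ _ (nbhs r) (nbhs y)) f2.
  apply: filterS2 f1 f2 => -[r' z] /= f1 f2.
  rewrite (splitr e) -(subrKA (f (r, y))) (le_trans (ler_normD _ _))// lerD//.
  by rewrite distrC.
near=> z.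
have -> : mean (fun r => f (r, y)) - mean (fun r => f (r, z)) =
    mean (fun r => -1 * f (r, z) + f (r, y)).
  by rewrite mean_linear ?mulN1r 1?addrC//; [apply: continuous_slice fc _; near: z|exact: continuous_slice fc _].
apply: mean_norm_le.
  move=> r; apply: cvgD; last exact: continuous_slice fc Wy r.
  apply: cvgM; first exact: cvg_cst.
  by apply: continuous_slice fc _ r; near: z.
move=> r r01; rewrite mulN1r addrC.
by move: r r01; near: z; exact: fn.
Unshelve. all: by end_near. Qed.

Lemma near_star (r : R) (Q : R -> E -> Prop) :
  (\forall r' \near r & h \near (0 : E), Q r' h) ->
  \forall r' \near r & h \near (0 : E), forall t : R, 0 <= t <= 1 -> Q r' (t *: h).
Proof.
move=> [[A B] [/= Ar /nbhs_ballP[d /= d0 dB]] ABQ].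
exists (A, ball 0 d); first by split=> //=; exact: nbhsx_ballx.
move=> [r' h] [/= Ar' hd] t /andP[t0 t1].
apply: (ABQ (r', t *: h)); split=> //=; apply: dB.
move: hd; rewrite -!ball_normE /ball_ /= !sub0r !normrN normrZ ger0_norm//.
by apply: le_lt_trans; rewrite ler_piMl.
Qed.

(** The estimate is uniform in r: near a point (r0, y) the partial derivatives of
    f vary by less than e / K, the mean value theorem turns this into the
    estimate, and finitely many r0 suffice. *)
Lemma slice_increment f W y : open W -> Ck 1 [set z | W z.2] f -> W y ->
  forall e : R, 0 < e -> \forall h \near (0 : E), forall r : R, 0 <= r <= 1 ->
    `|f (r, h + y) - f (r, y) - 'D_(0, h) f (r : R^o, y)| <= e * `|h|.
Proof.
move=> oW [df Df] Wy e e0; have [I [b [l [lc le]]]] := E_coords.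
have /choice[k lk] : forall i, exists k : R, 0 < k /\ forall h, `|l i h| <= k * `|h|.
  by move=> i; have [k] := linear_lipschitz (lc i); exists k.
(* l i is bounded by k i, so K controls the sum of the coordinates of h *)
pose K := \sum_i k i + 1.
have K0 : 0 < K by rewrite ltr_wpDl// sumr_ge0// => i _; rewrite ltW// (lk i).1.
have eK : 0 < e / K / 2 by rewrite !divr_gt0.
have Wn : \forall h \near (0 : E), W (h + y).
  by apply: near_translate; exact: open_nbhs_nbhs.
apply: near_segment => r0 r01.
pose Q (r : R) (h : E) := W (h + y) /\ forall i,
  `|'D_(0, b i) f (r0 : R^o, y) - 'D_(0, b i) f (r : R^o, h + y)| <= e / K / 2.
have /near_star : \forall r \near r0 & h \near (0 : E), Q r h.
  have Q1 : \forall r \near r0 & h \near (0 : E), W (h + y).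
    exact: (@cvg_snd _ _ (nbhs r0) (nbhs (0 : E))) Wn.
  have Q2 : \forall z \near filter_prod (nbhs r0) (nbhs (0 : E)), forall i,
      `|'D_(0, b i) f (r0 : R^o, y) - 'D_(0, b i) f (z.1 : R^o, z.2 + y)| <= e / K / 2.
    apply: filter_forall => i.
    have cD : {for (r0 : R^o, 0 : E), continuous
        (fun z : R^o * E => 'D_(0, b i) f (z.1, z.2 + y))}.
      apply: (@continuous_comp _ _ _ (fun z : R^o * E => (z.1, z.2 + y)) ('D_(0, b i) f)).
        apply: continuous_pair; first exact: cvg_fst.
        by apply: cvgD; [exact: cvg_snd|exact: cvg_cst].
      by apply: Df => /=; rewrite add0r.
    move/cvgrPdist_le : cD => /(_ _ eK) /=; rewrite add0r.
    by apply: filterS.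
  by apply: filterS2 Q1 Q2 => -[r h].
apply: filterS => -[r h] /= Qt.
have [|t t01 mv] := @mean_value R (R^o * E)%type f (r : R^o, y) (0, h).
  move=> t t01; apply: df => /=; exact: (Qt t t01).1.
rewrite /= in mv.
have E1 : (0, h) + (r : R^o, y) = (r : R^o, h + y) by congr pair; rewrite /= add0r.
have E2 : t *: (0, h) + (r : R^o, y) = (r : R^o, t *: h + y).
  by congr pair; rewrite /= scaler0 add0r.
rewrite E1 E2 in mv.
have {}mv : f (r, h + y) - f (r, y) = 'D_(0, h) f (r : R^o, t *: h + y) := mv.
have Q0 : Q r 0 by have := Qt 0; rewrite scale0r lexx ler01; exact.
have [Wth Qth] := Qt t t01.
have Dcoord z : W z.2 -> 'D_(0, h) f z = \sum_i l i h * 'D_(0, b i) f z.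
  move=> Wz; have dfz := df z Wz; rewrite deriveE//.
  have -> : (0 : R^o, h) = \sum_i l i h *: (0, b i).
    rewrite {1}(le h).
    apply: (big_ind2 (fun y (x : R^o * E) => (0, y) = x)) => //.
      by move=> y1 _ y2 _ <- <-; congr pair; rewrite /= addr0.
    by move=> i _; congr pair; rewrite /= scaler0.
  by rewrite linear_sum; apply: eq_bigr => i _; rewrite linearZ/= deriveE.
rewrite mv !Dcoord// -sumrB.
rewrite (le_trans (ler_norm_sum _ _ _))//.
apply: (@le_trans _ _ (\sum_i k i * `|h| * (e / K))).
  apply: ler_sum => i _; rewrite -mulrBr normrM ler_pM//; first exact: (lk i).2.
  have H1 := Qth i; have H2 := Q0.2 i; rewrite add0r in H2.
  rewrite distrC (splitr (e / K)) -(subrKA ('D_(0, b i) f (r0 : R^o, y))).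
  by rewrite (le_trans (ler_normD _ _))// lerD// distrC.
rewrite -!mulr_suml; apply: (@le_trans _ _ (K * `|h| * (e / K))).
  have eK0 : 0 <= e / K by rewrite divr_ge0// ltW.
  by apply: ler_wpM2r => //; apply: ler_wpM2r => //; rewrite /K lerDl.
by rewrite mulrC mulrA divfK// gt_eqF.
Qed.

Lemma diff_mean f W y : open W -> Ck 1 [set z | W z.2] f -> W y ->
  differentiable (fun y => mean (fun r => f (r, y)) : R^o) y /\
  forall v, 'd (fun y => mean (fun r => f (r, y)) : R^o) y v =
    mean (fun r => 'D_(0, v) f (r : R^o, y)).
Proof.
move=> oW fC Wy; have [df Df] := fC.
have Dc v : continuous (fun r : R => 'D_(0, v) f (r : R^o, y) : R).
  by apply: (@continuous_slice ('D_(0, v) f) W) => // z; exact: Df.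
have fc z : W z -> continuous (fun r : R => f (r, z) : R).
  by apply: continuous_slice => u Wu; apply: differentiable_continuous; exact: df.
have lin : linear (fun v => mean (fun r => 'D_(0, v) f (r : R^o, y)) : R^o).
  move=> a u v; rewrite -[RHS]/(_ * _ + _) -mean_linear//; congr mean.
  apply/funext => r; rewrite !deriveE; try exact: (df (r : R^o, y) Wy).
  have -> : (0, a *: u + v) = a *: (0 : R^o, u) + (0, v).
    by congr pair; rewrite /= scaler0 addr0.
  by rewrite linearP.
have [||dm dmE] := @is_diff_eps R E R^o (fun y => mean (fun r => f (r, y))) y (linear_map lin).
- exact: linear_continuous_coords.
- move=> e e0; have Wn : \forall h \near (0 : E), W (h + y).
    by apply: near_translate; exact: open_nbhs_nbhs.
  near=> h; have Wh : W (h + y) by near: h.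
  rewrite -[X in `|X|]/(mean (fun r => f (r, h + y)) - mean (fun r => f (r, y))
    - mean (fun r => 'D_(0, h) f (r : R^o, y))).
  have -> : mean (fun r => f (r, h + y)) - mean (fun r => f (r, y))
      - mean (fun r => 'D_(0, h) f (r : R^o, y)) =
      mean (fun r => -1 * 'D_(0, h) f (r : R^o, y) + (-1 * f (r, y) + f (r, h + y))).
    have gc : continuous (fun r : R => -1 * f (r, y) + f (r, h + y) : R).
      by move=> r; apply: cvgD; [apply: cvgM; [exact: cvg_cst|exact: fc]|exact: fc].
    by rewrite (mean_linear _ (Dc h) gc) (mean_linear _ (fc _ Wy) (fc _ Wh)); ring.
  apply: mean_norm_le.
    move=> r; apply: cvgD; first by apply: cvgM; [exact: cvg_cst|exact: Dc].
    by apply: cvgD; [apply: cvgM; [exact: cvg_cst|exact: fc]|exact: fc].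
  move=> r r01; rewrite [X in `|X|](_ : _ =
    f (r, h + y) - f (r, y) - 'D_(0, h) f (r : R^o, y)); last by ring.
  by move: r r01; near: h; exact: slice_increment fC Wy _ e0.
by split=> // v; rewrite dmE.
Unshelve. all: by end_near. Qed.

Lemma Ck_mean k f W : open W -> Ck k [set z | W z.2] f ->
  Ck k W (fun y => mean (fun r => f (r, y)) : R^o).
Proof.
move=> oW; elim: k f => [|k IH] f fC; first exact: Ck0_mean.
have fC1 : Ck 1 [set z | W z.2] f.
  split=> [z|v]; first exact: fC.1.
  by move: (fC.2 v); elim: (k) => // j IHj /Ck_pred.
split=> [y Wy|v]; first by have [] := diff_mean oW fC1 Wy.
apply: (@Ck_ext _ _ _ _ _ (fun y => mean (fun r => 'D_(0, v) f (r : R^o, y)) : R^o)) => //.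
  by move=> y Wy; have [dm dmE] := diff_mean oW fC1 Wy; rewrite deriveE.
apply: (IH ('D_(0, v) f)). exact: (fC.2 (0, v)).
Qed.

End ParametricMean.

(** * Maps from normed spaces to manifolds *)
Section MapsToManifolds.
Context {R : realType}.
Implicit Types E F : normedModType R.

(** The charts of a manifold, the curves in it and the local expressions of a
    group action are all maps from a normed space to a manifold; the differential
    [dmap] takes its values in the coordinates of the preferred chart, so that
    [frame c y] is [dmap (chart_inv c) y]. *)
Definition smooth_to E n (N : manifold R n) (Phi : E -> N) (z : E) : Prop :=
  {for z, continuous Phi} /\ smooth_at (chart_fun (chart_at (Phi z)) \o Phi) z.

Definition dmap E n (N : manifold R n) (Phi : E -> N) (z : E) : E -> 'rV[R]_n :=
  'd (chart_fun (chart_at (Phi z)) \o Phi) z.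

Lemma dmap_linear E n (N : manifold R n) (Phi : E -> N) (z : E) : linear (dmap Phi z).
Proof. by move=> a u v; rewrite /dmap linearP. Qed.

Lemma near_chart_dom n (N : manifold R n) (x y : N) : chart_dom (chart_at x) y ->
  \forall y' \near y, chart_dom (chart_at x) y'.
Proof. by move=> xy; apply: open_nbhs_nbhs; split=> //; exact: chart_dom_open. Qed.

Lemma near_comp (T U : topologicalType) (f : T -> U) (x : T) (Q : U -> Prop) :
  {for x, continuous f} -> (\forall y \near f x, Q y) -> \forall y \near x, Q (f y).
Proof. by move=> fx Qf; exact: fx. Qed.

Lemma near_through_chart E n (N : manifold R n) (Phi : E -> N) (z : E) (x : N) :
  {for z, continuous Phi} -> chart_dom (chart_at x) (Phi z) ->
  \forall z' \near z, Phi z' = chart_inv (chart_at x) (chart_fun (chart_at x) (Phi z')).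
Proof.
move=> Phic xz; apply: filterS (near_comp Phic (near_chart_dom xz)) => z' dz'.
by rewrite chart_funK.
Qed.

Lemma smooth_change_chart E n (N : manifold R n) (Phi : E -> N) (z : E) (x y : N) :
  {for z, continuous Phi} ->
  chart_dom (chart_at x) (Phi z) -> chart_dom (chart_at y) (Phi z) ->
  smooth_at (chart_fun (chart_at x) \o Phi) z ->
  smooth_at (chart_fun (chart_at y) \o Phi) z.
Proof.
move=> Phic xz yz sx.
apply: near_eq_smooth (smooth_at_comp (g := chart_fun (chart_at y) \o chart_inv (chart_at x)) _ _ sx _).
- by apply: filterS (near_through_chart Phic xz) => z' /= <-.
- exact: finite_coords_rV.
- exact: finite_coords_rV.
- exact: chart_compat.
Qed.

Lemma smooth_to_chart E n (N : manifold R n) (Phi : E -> N) (z : E) (x : N) :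
  {for z, continuous Phi} -> chart_dom (chart_at x) (Phi z) ->
  smooth_to Phi z <-> smooth_at (chart_fun (chart_at x) \o Phi) z.
Proof.
move=> Phic xz; split=> [[_]|s]; first exact: smooth_change_chart Phic (mem_chart_at _) xz.
by split=> //; exact: smooth_change_chart Phic xz (mem_chart_at _) s.
Qed.

Lemma near_eq_continuous (T U : topologicalType) (f g : T -> U) (x : T) :
  (\forall y \near x, f y = g y) -> {for x, continuous f} -> {for x, continuous g}.
Proof.
move=> fg; rewrite /prop_for /continuous_at (nbhs_singleton fg) => fc.
exact: cvg_trans (near_eq_cvg fg) fc.
Qed.

Lemma smooth_to_near_eq E n (N : manifold R n) (Phi Psi : E -> N) (z : E) :
  (\forall z' \near z, Phi z' = Psi z') -> smooth_to Phi z -> smooth_to Psi z.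
Proof.
move=> PP [Phic sPhi]; split; first exact: near_eq_continuous Phic.
apply: near_eq_smooth sPhi; rewrite -(nbhs_singleton PP).
by apply: filterS PP => z' /= ->.
Qed.

Lemma dmap_near_eq E n (N : manifold R n) (Phi Psi : E -> N) (z v : E) :
  (\forall z' \near z, Phi z' = Psi z') -> smooth_to Phi z ->
  dmap Psi z v = dmap Phi z v.
Proof.
move=> PP [Phic sPhi]; rewrite /dmap -(nbhs_singleton PP).
have PPc : \forall z' \near z, (chart_fun (chart_at (Phi z)) \o Phi) z' =
    (chart_fun (chart_at (Phi z)) \o Psi) z' by apply: filterS PP => z' /= ->.
have [_ E1] := near_eq_diff PPc (smooth_at_diff sPhi).
exact: (congr1 (fun g => g v) E1).
Qed.

Lemma chart_inv_smooth n (N : manifold R n) (x : N) (y : 'rV[R]_n) :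
  (chart_fun (chart_at x) @` chart_dom (chart_at x)) y ->
  smooth_to (chart_inv (chart_at x)) y.
Proof.
move=> [z xz <-]; split.
  by apply: chart_inv_continuous; exists z.
by rewrite chart_funK//; apply: chart_compat => //; exact: mem_chart_at.
Qed.

Lemma coord_img n (N : manifold R n) (x : N) :
  (chart_fun (chart_at x) @` chart_dom (chart_at x)) (coord x).
Proof. by exists x => //; exact: mem_chart_at. Qed.

Lemma chart_inv_coord n (N : manifold R n) (x : N) : chart_inv (chart_at x) (coord x) = x.
Proof. by rewrite chart_funK//; exact: mem_chart_at. Qed.

Lemma near_chart_img n (N : manifold R n) (x : N) y :
  (chart_fun (chart_at x) @` chart_dom (chart_at x)) y ->
  \forall y' \near y, (chart_fun (chart_at x) @` chart_dom (chart_at x)) y'.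
Proof. by move=> xy; apply: open_nbhs_nbhs; split=> //; exact: chart_img_open. Qed.

Lemma chart_invK n (N : manifold R n) (x : N) y :
  (chart_fun (chart_at x) @` chart_dom (chart_at x)) y ->
  chart_fun (chart_at x) (chart_inv (chart_at x) y) = y.
Proof. by move=> [z xz <-]; rewrite chart_funK. Qed.

Lemma near_coord n (N : manifold R n) (x : N) (Q : N -> Prop) :
  (\forall x' \near x, Q x') ->
  \forall y \near coord x, Q (chart_inv (chart_at x) y).
Proof.
move=> Qx; apply: (near_comp (f := chart_inv (chart_at x))).
  by apply: chart_inv_continuous; exact: coord_img.
by rewrite chart_inv_coord.
Qed.

Lemma near_smooth_to E n (N : manifold R n) (Phi : E -> N) (z : E) :
  smooth_to Phi z -> \forall z' \near z, smooth_to Phi z'.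
Proof.
move=> [Phic sPhi]; set c := chart_at (Phi z).
have sn := near_smooth_at sPhi.
have dn := near_comp Phic (near_chart_dom (mem_chart_at (Phi z))).
have /nbhs_interior en := near_through_chart Phic (mem_chart_at (Phi z)).
apply: filterS3 sn dn en => z' sz' dz' ez'.
have Phic' : {for z', continuous Phi}.
  apply: (near_eq_continuous (f := chart_inv c \o (chart_fun c \o Phi))).
    by apply: filterS ez' => w /= <-.
  apply: continuous_comp; first exact: smooth_at_continuous.
  by apply: chart_inv_continuous; exists (Phi z').
by apply/(smooth_to_chart Phic' dz').
Qed.

Lemma smooth_to_comp E F n (N : manifold R n) (f : E -> F) (Phi : F -> N) (z : E) :
  finite_coords F -> smooth_at f z -> smooth_to Phi (f z) -> smooth_to (Phi \o f) z.
Proof.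
move=> fcF sf [Phic sPhi]; split.
  by apply: continuous_comp => //; exact: smooth_at_continuous.
apply: (smooth_at_comp (g := chart_fun (chart_at (Phi (f z))) \o Phi)) => //.
exact: finite_coords_rV.
Qed.

Lemma dmap_comp E F n (N : manifold R n) (f : E -> F) (Phi : F -> N) (z v : E) :
  smooth_at f z -> smooth_to Phi (f z) ->
  dmap (Phi \o f) z v = dmap Phi (f z) ('d f z v).
Proof.
move=> sf [Phic sPhi]; rewrite /dmap.
by have -> := diff_comp (smooth_at_diff sf) (smooth_at_diff sPhi).
Qed.

Lemma near_local_expr E m n (M : manifold R m) (N : manifold R n) (f : M -> N)
    (Phi : E -> M) (z : E) : {for z, continuous Phi} ->
  \forall z' \near z, (local_expr f (Phi z) \o (chart_fun (chart_at (Phi z)) \o Phi)) z'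
     = (chart_fun (chart_at (f (Phi z))) \o (f \o Phi)) z'.
Proof.
move=> Phic.
rewrite /local_expr; apply: filterS (near_through_chart Phic (mem_chart_at _)) => z' /= E1.
by rewrite -E1.
Qed.

Lemma smooth_to_map E m n (M : manifold R m) (N : manifold R n) (f : M -> N)
    (Phi : E -> M) (z : E) :
  smooth_to Phi z -> smooth_map_at f (Phi z) -> smooth_to (f \o Phi) z.
Proof.
move=> [Phic sPhi] [fc sf]; split; first exact: continuous_comp.
apply: near_eq_smooth (near_local_expr f Phic) _.
by apply: smooth_at_comp => //; exact: finite_coords_rV.
Qed.

Lemma dmap_map E m n (M : manifold R m) (N : manifold R n) (f : M -> N)
    (Phi : E -> M) (z v : E) :
  smooth_to Phi z -> smooth_map_at f (Phi z) ->
  dmap (f \o Phi) z v = tangent f (Phi z) (dmap Phi z v).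
Proof.
move=> [Phic sPhi] [fc sf]; rewrite /dmap /tangent.
have dl := smooth_at_diff sPhi; have dg := smooth_at_diff sf.
have [_ ->] := near_eq_diff (near_local_expr f Phic) (differentiable_comp dl dg).
by rewrite (diff_comp dl dg).
Qed.

Lemma dmap_chart_inv n (N : manifold R n) (x : N) v :
  dmap (chart_inv (chart_at x)) (coord x) v = v.
Proof.
rewrite /dmap chart_inv_coord.
have idE : \forall y \near coord x,
    idfun y = (chart_fun (chart_at x) \o chart_inv (chart_at x)) y.
  by apply: filterS (near_chart_img (coord_img x)) => y xy /=; rewrite chart_invK.
have idc : continuous (idfun : 'rV[R]_n -> 'rV[R]_n) by move=> y; exact: cvg_id.
have did : differentiable (idfun : 'rV[R]_n -> 'rV[R]_n) (coord x).
  exact: linear_differentiable.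
have [_ E1] := near_eq_diff idE did.
by rewrite (congr1 (fun g => g v) E1) diff_lin.
Qed.

Lemma tangentE m n (M : manifold R m) (N : manifold R n) (f : M -> N) (x : M) v :
  tangent f x v = dmap (f \o chart_inv (chart_at x)) (coord x) v.
Proof. by rewrite /dmap /= chart_inv_coord. Qed.

Lemma smooth_mapE m n (M : manifold R m) (N : manifold R n) (f : M -> N) (x : M) :
  {for x, continuous f} ->
  smooth_to (f \o chart_inv (chart_at x)) (coord x) -> smooth_map_at f x.
Proof. by move=> fc [_]; rewrite /= chart_inv_coord. Qed.

Lemma smooth_map_to m n (M : manifold R m) (N : manifold R n) (f : M -> N) (x : M) y :
  (chart_fun (chart_at x) @` chart_dom (chart_at x)) y ->
  smooth_map_at f (chart_inv (chart_at x) y) ->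
  smooth_to (f \o chart_inv (chart_at x)) y.
Proof. by move=> xy; apply: smooth_to_map; exact: chart_inv_smooth. Qed.

Lemma tangent_linear m n (M : manifold R m) (N : manifold R n) (f : M -> N) (x : M) :
  linear (tangent f x).
Proof. by move=> a u v; rewrite /tangent linearP. Qed.

Lemma smooth_map_comp l m n (L : manifold R l) (M : manifold R m) (N : manifold R n)
    (f : L -> M) (g : M -> N) (x : L) :
  smooth_map_at f x -> smooth_map_at g (f x) -> smooth_map_at (g \o f) x.
Proof.
move=> sf sg; apply: smooth_mapE.
  by apply: continuous_comp; [exact: sf.1|exact: sg.1].
rewrite -compA; apply: (smooth_to_map (f := g)); last by rewrite /= chart_inv_coord.
by apply: smooth_map_to; [exact: coord_img|rewrite chart_inv_coord].
Qed.

Lemma tangent_comp l m n (L : manifold R l) (M : manifold R m) (N : manifold R n)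
    (f : L -> M) (g : M -> N) (x : L) v :
  smooth_map_at f x -> smooth_map_at g (f x) ->
  tangent (g \o f) x v = tangent g (f x) (tangent f x v).
Proof.
move=> sf sg; pose Phi := f \o chart_inv (chart_at x).
have Phi_x : Phi (coord x) = f x by rewrite /Phi /= chart_inv_coord.
have sPhi : smooth_to Phi (coord x).
  by apply: smooth_map_to; [exact: coord_img|rewrite chart_inv_coord].
transitivity (dmap (g \o Phi) (coord x) v); first exact: tangentE.
transitivity (tangent g (Phi (coord x)) (dmap Phi (coord x) v)).
  by apply: dmap_map => //; rewrite Phi_x.
by rewrite Phi_x (tangentE f).
Qed.

Lemma tangent_near_eq m n (M : manifold R m) (N : manifold R n) (f g : M -> N) (x : M) v :
  (\forall x' \near x, f x' = g x') -> smooth_map_at f x ->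
  tangent g x v = tangent f x v.
Proof.
move=> fg sf; rewrite (tangentE f) (tangentE g).
apply: dmap_near_eq; first exact: (near_coord fg).
by apply: smooth_map_to; [exact: coord_img|rewrite chart_inv_coord].
Qed.

Lemma smooth_map_near_eq m n (M : manifold R m) (N : manifold R n) (f g : M -> N) (x : M) :
  (\forall x' \near x, f x' = g x') -> smooth_map_at f x -> smooth_map_at g x.
Proof.
move=> fg sf; apply: smooth_mapE; first exact: near_eq_continuous fg sf.1.
apply: smooth_to_near_eq (near_coord fg) _.
by apply: smooth_map_to; [exact: coord_img|rewrite chart_inv_coord].
Qed.

Lemma tangent_id n (N : manifold R n) (x : N) v : tangent id x v = v.
Proof. by rewrite tangentE; exact: dmap_chart_inv. Qed.

Lemma smooth_map_id n (N : manifold R n) (x : N) : smooth_map_at (id : N -> N) x.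
Proof.
apply: smooth_mapE; first exact: cvg_id.
exact: chart_inv_smooth (coord_img x).
Qed.

End MapsToManifolds.

(** * Pulled back 1-forms and their exterior derivatives *)
Section Forms.
Context {R : realType}.
Implicit Types E F : normedModType R.

Definition pull1 E n (N : manifold R n) (Phi : E -> N) (t : field1 N) (v : E) :
    E -> R^o := fun z => t (Phi z) (dmap Phi z v).

Lemma linear_fun0 n (f : 'rV[R]_n -> R) :
  (forall a u v, f (a *: u + v) = a * f u + f v) -> f 0 = 0.
Proof.
move=> fl; have := fl 1 0 0; rewrite scaler0 addr0 mul1r => /eqP.
by rewrite -subr_eq0 opprD addrA subrr sub0r oppr_eq0 => /eqP.
Qed.

Lemma linear_sum_coords n (f : 'rV[R]_n -> R) :
  (forall a u v, f (a *: u + v) = a * f u + f v) ->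
  forall v, f v = \sum_i v ord0 i * f (delta_mx ord0 i).
Proof.
move=> fl v.
have fl' : linear (f : 'rV[R]_n -> R^o) by exact: fl.
rewrite {1}(row_sum_delta v); rewrite -[f]/(linear_map fl' : _ -> _) linear_sum.
by apply: eq_bigr => i _; rewrite linearZ.
Qed.

Lemma coord_fun_linear n (i : 'I_n) : linear (fun v : 'rV[R]_n => v ord0 i : R^o).
Proof. by move=> a u v; rewrite !mxE. Qed.

Lemma coord_smooth E n (f : E -> 'rV[R]_n) z i :
  smooth_at f z -> smooth_at (fun y => f y ord0 i : R^o) z.
Proof.
move=> sf.
apply: (smooth_at_linear_comp (L := linear_map (coord_fun_linear i))) => //.
exact: coord_continuous.
Qed.

Lemma derive_coord E n (f : E -> 'rV[R]_n) z u i :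
  differentiable f z -> ('D_u f z) ord0 i = 'D_u (fun y => f y ord0 i : R^o) z.
Proof.
move=> df; pose L := linear_map (coord_fun_linear i).
have Lc : continuous L by exact: coord_continuous.
have dL : differentiable L (f z) by exact: linear_differentiable.
rewrite -[fun y => _]/(L \o f) (deriveE _ df) (deriveE _ (differentiable_comp df dL)).
by rewrite (diff_comp df dL) -[RHS]/('d L (f z) ('d f z u)) diff_lin.
Qed.

(** The preferred chart at Phi z' changes with z'; in the one chart around Phi z the
    pullback becomes a sum of products of smooth functions of z'. *)
Lemma near_pull1 E n (N : manifold R n) (Phi : E -> N) (t : field1 N) (z v : E) :
  smooth_to Phi z -> form1 t ->
  \forall z' \near z, pull1 Phi t v z' =
    \sum_i ('D_v (chart_fun (chart_at (Phi z)) \o Phi) z') ord0 i *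
       comp1 (chart_at (Phi z)) t (delta_mx ord0 i) (chart_fun (chart_at (Phi z)) (Phi z')).
Proof.
move=> sPhi ft; have [Phic sPhi'] := sPhi; set c := chart_at (Phi z).
have sn := near_smooth_at sPhi'.
have dn := near_comp Phic (near_chart_dom (mem_chart_at (Phi z))).
have /nbhs_interior en := near_through_chart Phic (mem_chart_at (Phi z)).
have n1 := near_smooth_to sPhi.
apply: filterS3 (filterI sn dn) en n1 => z' [sz' dz'] ez' s1.
have img : (chart_fun c @` chart_dom c) (chart_fun c (Phi z')) by exists (Phi z').
have Dphi : dmap Phi z' v =
    dmap (chart_inv c) (chart_fun c (Phi z')) ('D_v (chart_fun c \o Phi) z').
  rewrite (deriveE _ (smooth_at_diff sz')).
  transitivity (dmap (chart_inv c \o (chart_fun c \o Phi)) z' v).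
    by apply/esym; apply: dmap_near_eq => //; exact: ez'.
  by apply: dmap_comp => //; exact: chart_inv_smooth.
have -> : pull1 Phi t v z' =
    comp1 c t ('D_v (chart_fun c \o Phi) z') (chart_fun c (Phi z')).
  exact: (f_equal2 t (nbhs_singleton ez') Dphi).
have [tl _] := ft (chart_inv c (chart_fun c (Phi z'))) I.
apply: (@linear_sum_coords _ (fun w => comp1 c t w (chart_fun c (Phi z')))) => a u w.
by rewrite /comp1 -tl; congr (t _ _); exact: dmap_linear.
Qed.

Lemma smooth_comp1 E n (N : manifold R n) (Phi : E -> N) (t : field1 N) (z : E) u :
  smooth_to Phi z -> form1 t ->
  smooth_at (fun z' => comp1 (chart_at (Phi z)) t u (chart_fun (chart_at (Phi z)) (Phi z')))  z.
Proof.
move=> [Phic sPhi] ft; have [_ ts] := ft (Phi z) I.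
apply: (smooth_at_comp (g := comp1 (chart_at (Phi z)) t u)) sPhi (ts u).
  exact: finite_coords_rV.
exact: finite_coords_R.
Qed.

Lemma smooth_pull1 E n (N : manifold R n) (Phi : E -> N) (t : field1 N) (z v : E) :
  smooth_to Phi z -> form1 t -> smooth_at (pull1 Phi t v) z.
Proof.
move=> sPhi ft; have [Phic sPhi'] := sPhi.
apply: near_eq_smooth.
  by apply: filterS (near_pull1 v sPhi ft) => z' ->; reflexivity.
apply: smooth_at_sum => i; apply: smooth_atM; last exact: smooth_comp1.
by apply: coord_smooth; exact: smooth_at_derive.
Qed.

(** The exterior derivative commutes with pullbacks: in the formula of
    [near_pull1] the second derivatives of Phi are symmetric and cancel. *)
Lemma ext1_pull1 E n (N : manifold R n) (Phi : E -> N) (t : field1 N) (z u v : E) :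
  smooth_to Phi z -> form1 t ->
  'D_u (pull1 Phi t v) z - 'D_v (pull1 Phi t u) z =
    ext1 t (Phi z) (dmap Phi z u) (dmap Phi z v).
Proof.
move=> sPhi ft; have [Phic sPhi'] := sPhi.
set c := chart_at (Phi z); set phi := chart_fun c \o Phi.
pose a i := comp1 c t (delta_mx ord0 i).
have sa i : smooth_at (a i) (coord (Phi z)) by exact: (ft (Phi z) I).2.
have saphi i : smooth_at (fun z' => a i (phi z')) z by exact: smooth_comp1.
have sphi i : smooth_at (fun z' => phi z' ord0 i : R^o) z by exact: coord_smooth.
have Dpull u' v' : 'D_u' (pull1 Phi t v') z =
   \sum_i ('D_u' ('D_v' (fun z' => phi z' ord0 i : R^o)) z * a i (phi z) +
           (dmap Phi z v') ord0 i * 'd (a i) (coord (Phi z)) (dmap Phi z u')).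
  have np : \forall z' \near z, pull1 Phi t v' z' =
     (\sum_i (fun y : E => 'D_v' (fun z' => phi z' ord0 i : R^o) y * a i (phi y) : R^o)) z'.
    apply: filterS2 (near_pull1 v' sPhi ft) (near_smooth_at sPhi') => z' -> s1.
    rewrite fct_sumE; apply: eq_bigr => i _; congr (_ * _).
    exact: derive_coord (smooth_at_diff s1).
  rewrite (near_eq_derive _ np) derive_sum; last first.
    move=> i; apply: diff_derivable; apply: smooth_at_diff; apply: smooth_atM => //.
    exact: smooth_at_derive.
  apply: eq_bigr => i _.
  have d1 : differentiable ('D_v' (fun z' => phi z' ord0 i : R^o) : E -> R^o) z.
    by apply: smooth_at_diff; exact: smooth_at_derive.
  have d2 := smooth_at_diff (saphi i).
  rewrite deriveM; try exact: diff_derivable.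
  rewrite [LHS]addrC; congr (_ + _); first exact: mulrC.
  rewrite /GRing.scale /=.
  congr (_ * _).
    by rewrite -derive_coord ?deriveE//; exact: smooth_at_diff.
  rewrite (deriveE _ d2).
  have dphi := smooth_at_diff sPhi'.
  have da : differentiable (a i) (phi z) by exact: smooth_at_diff (sa i).
  by rewrite (diff_comp dphi da).
rewrite !Dpull -sumrB /ext1 -/c.
have tl x := (ft x I).1.
have Dcomp w w' : 'D_w (comp1 c t w') (coord (Phi z)) =
    \sum_i w' ord0 i * 'd (a i) (coord (Phi z)) w.
  have cE : comp1 c t w' = \sum_i (w' ord0 i *: a i).
    apply/funext => y; rewrite fct_sumE.
    apply: (@linear_sum_coords _ (fun w => comp1 c t w y)) => k x1 x2.
    by rewrite /comp1 -tl; congr (t _ _); exact: dmap_linear.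
  have da i : differentiable (a i) (coord (Phi z)) by exact: smooth_at_diff.
  rewrite cE derive_sum; last first.
    by move=> i; apply: diff_derivable; apply: differentiableZ.
  apply: eq_bigr => i _; rewrite deriveZ ?deriveE//.
  exact: diff_derivable.
rewrite !Dcomp -sumrB; apply: eq_bigr => i _.
by rewrite (derive_commute _ _ (sphi i)); ring.
Qed.

End Forms.

Section Pullback.
Context {R : realType}.

(** The form s on the source need only be a pullback near x: a form glued from
    local pullbacks is handled in this way. *)
Lemma pullback_local m n (M : manifold R m) (N : manifold R n) (f : M -> N)
    (t : field1 N) (s : field1 M) (x : M) : form1 t ->
  (\forall x' \near x, smooth_map_at f x' /\
     forall v, s x' v = t (f x') (tangent f x' v)) ->
  (forall u, smooth_at (comp1 (chart_at x) s u) (coord x)) /\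
  (forall u v, ext1 s x u v = ext1 t (f x) (tangent f x u) (tangent f x v)).
Proof.
move=> ft sE; set c := chart_at x; pose Phi := f \o chart_inv c.
have [sf _] := nbhs_singleton sE.
have sPhi : smooth_to Phi (coord x).
  by apply: smooth_map_to; [exact: coord_img|rewrite chart_inv_coord].
have near_comp1 u : \forall y \near coord x, pull1 Phi t u y = comp1 c s u y.
  apply: filterS2 (near_coord sE) (near_chart_img (coord_img x)) => y [sfy sy] yimg.
  rewrite /comp1 sy; congr (t _ _).
  exact: (dmap_map _ (chart_inv_smooth yimg) sfy).
split=> [u|u v]; first by apply: near_eq_smooth (near_comp1 u) _; exact: smooth_pull1.
rewrite /ext1 -/c -(near_eq_derive u (near_comp1 v)) -(near_eq_derive v (near_comp1 u)).
rewrite (ext1_pull1 u v sPhi ft).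
have Phi_x : Phi (coord x) = f x by rewrite /Phi /= chart_inv_coord.
exact: (f_equal3 (ext1 t) Phi_x (esym (tangentE f x u)) (esym (tangentE f x v))).
Qed.

End Pullback.

(** * Segments and star-shaped neighbourhoods *)

Section Segments.
Context {R : realType}.

(** Connectedness of a segment.  Lifts of paths are built, compared and deformed
    through suitable choices of S. *)
Lemma locally_constant_segment (S : R -> Prop) (a b : R) : a <= b ->
  (forall t, a <= t <= b -> \forall t' \near t, S t' <-> S t) -> S a -> S b.
Proof.
move=> ab Sloc Sa.
pose B := [set t | a <= t <= b /\ S t].
suff BE : B = `[a, b]%classic.
  have : B b by rewrite BE /= in_itv /= ab lexx.
  by case.
have segE t : `[a, b]%classic t -> a <= t <= b by rewrite /= in_itv.
apply: (@segment_connected R a b).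
- by exists a; split; rewrite ?lexx.
- exists (S^°); first exact: open_interior.
  apply/seteqP; split=> t [tab St]; last by split; [exact: segE|exact: nbhs_singleton St].
  split; first by rewrite /= in_itv.
  by apply: filterS (Sloc t tab) => t' [_]; exact.
- exists (~` (~` S)^°); first by apply: open_closedC; exact: open_interior.
  apply/seteqP; split=> t [tab St].
    by split; [rewrite /= in_itv|move=> /nbhs_singleton].
  split; first exact: segE.
  apply: contrapT => nSt; apply: St.
  by apply: filterS (Sloc t (segE t tab)) => t' [+ _] => /[swap] St' /(_ St').
Qed.


End Segments.

Lemma near_star_shaped (R : realType) (E : normedModType R) (x : E) (W : set E) :
  nbhs x W -> \forall y \near x, forall t : R, 0 <= t <= 1 -> W (t *: (y - x) + x).
Proof.
move=> /nbhs_ballP[d /= d0 dW]; apply/nbhs_ballP; exists d => //= y xy t /andP[t0 t1].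
apply: dW; move: xy; rewrite -!ball_normE /ball_ /= opprD addrCA subrr addr0 normrN.
by rewrite distrC normrZ ger0_norm//; apply: le_lt_trans; rewrite ler_piMl.
Qed.

(** * Averaging a closed form over a circle action *)
Section CircleAction.
Context {R : realType} {n : nat} {P : manifold R n}.
Variable act : R -> P -> P.
Hypothesis act_smooth : smooth_action act.
Hypothesis act0 : forall q, act 0 q = q.
Hypothesis actD : forall s t q, act (s + t) q = act s (act t q).
Hypothesis act1 : forall q, act 1 q = q.

Local Notation img q := (chart_fun (chart_at q) @` chart_dom (chart_at q)).

Definition act_chart (q : P) : (R^o * 'rV[R]_n)%type -> P :=
  fun z => act z.1 (chart_inv (chart_at q) z.2).

Lemma smooth_slice_pair (r : R) (y : 'rV[R]_n) :
  smooth_at (fun y : 'rV[R]_n => (r : R^o, y)) y /\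
  forall u, 'd (fun y : 'rV[R]_n => (r : R^o, y)) y u = (0, u).
Proof.
have idc : continuous (idfun : 'rV[R]_n -> 'rV[R]_n) by move=> z; exact: cvg_id.
split=> [|u].
  apply: (smooth_at_pair (f := fun=> r : R^o) (g := idfun)).
  - exact: finite_coords_R.
  - exact: finite_coords_rV.
  - exact: smooth_at_cst.
  - exact: smooth_at_linear.
have d1 : differentiable (fun=> r : R^o) y by exact: differentiable_cst.
have d2 : differentiable (idfun : 'rV[R]_n -> 'rV[R]_n) y by exact: linear_differentiable.
have := congr1 (fun g => g u) (diff_pair d1 d2); rewrite /= diff_cst diff_lin//.
Qed.

Lemma smooth_pair_slice (r : R) (y : 'rV[R]_n) :
  smooth_at (fun r : R^o => (r : R^o, y)) (r : R^o) /\
  forall u : R^o, 'd (fun r : R^o => (r : R^o, y)) (r : R^o) u = (u, 0).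
Proof.
have idc : continuous (idfun : R^o -> R^o) by move=> z; exact: cvg_id.
split=> [|u].
  apply: (smooth_at_pair (f := idfun) (g := fun=> y)).
  - exact: finite_coords_R.
  - exact: finite_coords_rV.
  - exact: smooth_at_linear.
  - exact: smooth_at_cst.
have d1 : differentiable (fun=> y) (r : R^o) by exact: differentiable_cst.
have d2 : differentiable (idfun : R^o -> R^o) (r : R^o) by exact: linear_differentiable.
have := congr1 (fun g => g u) (diff_pair d2 d1); rewrite /= diff_cst diff_lin//.
Qed.

Lemma act_chart_smooth (q : P) (r : R) (y : 'rV[R]_n) : img q y ->
  smooth_to (act_chart q) (r : R^o, y).
Proof.
move=> qy; set q' := chart_inv (chart_at q) y.
have sinv := chart_inv_smooth qy; have cinv := sinv.1.
have [actc acts] := act_smooth r q'.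
have Ac : {for (r : R^o, y), continuous (act_chart q)}.
  apply: (@continuous_comp _ _ _ (fun z : R^o * 'rV[R]_n => (z.1 : R, chart_inv (chart_at q) z.2))
     (fun z : R * P => act z.1 z.2)); last exact: actc.
  apply: continuous_pair; first exact: cvg_fst.
  by apply: (@continuous_comp _ _ _ snd (chart_inv (chart_at q))); [exact: cvg_snd|exact: cinv].
split=> //.
pose g (z : R^o * 'rV[R]_n) : R^o * 'rV[R]_n :=
  (z.1, chart_fun (chart_at q') (chart_inv (chart_at q) z.2)).
have sg : smooth_at g (r : R^o, y).
  have lin1 : linear (fst : R^o * 'rV[R]_n -> R^o) by [].
  have lin2 : linear (snd : R^o * 'rV[R]_n -> 'rV[R]_n) by [].
  apply: smooth_at_pair; [exact: finite_coords_R|exact: finite_coords_rV| |].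
    apply: (smooth_at_linear (L := linear_map lin1)).
    by move=> z; exact: cvg_fst.
  apply: (smooth_at_comp (f := linear_map lin2) (g := chart_fun (chart_at q') \o chart_inv (chart_at q))).
  - exact: finite_coords_rV.
  - exact: finite_coords_rV.
  - by apply: smooth_at_linear => z; exact: cvg_snd.
  - exact: sinv.2.
apply: near_eq_smooth (smooth_at_comp (g := action_expr act r q') _ _ sg _).
- have := near_through_chart cinv (mem_chart_at q').
  have snd_c : {for (r : R^o, y), continuous (snd : R^o * 'rV[R]_n -> 'rV[R]_n)}.
    exact: cvg_snd.
  move=> H; have := @near_comp _ _ snd (r : R^o, y) _ snd_c H.
  by apply: filterS => -[s z] /= E1; rewrite /action_expr /act_chart /= -E1.
- by apply: finite_coords_prod; [exact: finite_coords_R|exact: finite_coords_rV].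
- exact: finite_coords_rV.
- exact: acts.
Qed.

Lemma act_smooth_map (r : R) (q : P) : smooth_map_at (act r) q.
Proof.
have [actc _] := act_smooth r q.
apply: smooth_mapE.
  apply: (@continuous_comp _ _ _ (fun q : P => (r, q)) (fun z : R * P => act z.1 z.2)).
    by apply: continuous_pair; [exact: cvg_cst|exact: cvg_id].
  exact: actc.
apply: (smooth_to_comp (f := fun y : 'rV[R]_n => (r : R^o, y)) (Phi := act_chart q)).
- by apply: finite_coords_prod; [exact: finite_coords_R|exact: finite_coords_rV].
- exact: (smooth_slice_pair r _).1.
- exact: act_chart_smooth (coord_img q).
Qed.

Definition flow_line (q : P) : R^o -> P := fun r => act r q.

Lemma flow_line_smooth q r : smooth_to (flow_line q) r.
Proof.
apply: smooth_to_near_eq (smooth_to_comp (f := fun r : R^o => (r : R^o, coord q)) (Phi := act_chart q) (z := r) _ _ _).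
- by near=> s; rewrite /act_chart /= chart_inv_coord.
- by apply: finite_coords_prod; [exact: finite_coords_R|exact: finite_coords_rV].
- exact: (smooth_pair_slice r _).1.
- exact: act_chart_smooth (coord_img q).
Unshelve. all: by end_near. Qed.

Lemma generatorE q : generator act q = dmap (flow_line q) 0 1.
Proof.
have s0 := (flow_line_smooth q 0).2.
have e : flow_line q 0 = q by rewrite /flow_line act0.
rewrite e in s0; rewrite /generator /dmap e.
exact: (derive1E' (smooth_at_diff s0)).
Qed.

Lemma smooth_translate (r s : R) :
  smooth_at (fun t : R^o => t + r : R^o) (s : R^o) /\
  forall u : R^o, 'd (fun t : R^o => t + r : R^o) (s : R^o) u = u.
Proof.
have idc : continuous (idfun : R^o -> R^o) by move=> z; exact: cvg_id.
split.
  by apply: (smooth_atD (f := idfun)); [exact: smooth_at_linear|exact: smooth_at_cst].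
move=> u.
have d1 : differentiable (fun=> r : R^o) (s : R^o) by exact: differentiable_cst.
have d2 : differentiable (idfun : R^o -> R^o) (s : R^o) by exact: linear_differentiable.
have := congr1 (fun g => g u) (diffD d2 d1); rewrite /= diff_cst diff_lin//.
by rewrite fctE /= addr0.
Qed.

Lemma dmap_flow_line q (r : R) : dmap (flow_line q) r 1 = generator act (act r q).
Proof.
have [st dt] := smooth_translate (- r) r.
have sub : (r : R^o) - r = 0 by rewrite subrr.
have s0 : smooth_to (flow_line (act r q)) ((r : R^o) - r) by exact: flow_line_smooth.
have E1 := @dmap_comp R R^o R^o _ P (fun t : R^o => t - r) (flow_line (act r q)) (r : R^o) (1 : R^o) st s0.
rewrite dt in E1.
rewrite generatorE -[in RHS]sub -E1.
apply/esym; apply: dmap_near_eq; last exact: flow_line_smooth.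
by near=> s; rewrite /flow_line /= -actD subrK.
Unshelve. all: by end_near. Qed.

(** The two partial differentials of the action: its generator in the direction of
    time, and the tangent map of [act r] in the direction of space. *)
Lemma dmap_act_chart_flow q (r : R) y : img q y ->
  dmap (act_chart q) (r : R^o, y) (1, 0) =
  generator act (act r (chart_inv (chart_at q) y)).
Proof.
move=> qy; have [s1 d1] := smooth_pair_slice r y.
have := @dmap_comp R R^o _ _ P _ _ (r : R^o) (1 : R^o) s1 (act_chart_smooth r qy); rewrite d1 => <-.
by rewrite -dmap_flow_line.
Qed.

Lemma dmap_act_chart_space q (r : R) y u : img q y ->
  dmap (act_chart q) (r : R^o, y) (0, u) =
  tangent (act r) (chart_inv (chart_at q) y) (frame (chart_at q) y u).
Proof.
move=> qy; have [s1 d1] := smooth_slice_pair r y.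
have := dmap_comp u s1 (act_chart_smooth r qy); rewrite d1 => <-.
exact: (dmap_map u (chart_inv_smooth qy) (act_smooth_map r _)).
Qed.

Lemma tangent_generator t q : tangent (act t) q (generator act q) = generator act (act t q).
Proof.
have E1 : flow_line q 0 = q by rewrite /flow_line act0.
have := @dmap_map _ _ _ _ _ _ (act t) (flow_line q) 0 1 (flow_line_smooth q 0) (act_smooth_map t _).
rewrite E1 -generatorE => <-; rewrite generatorE; apply: dmap_near_eq.
  by near=> s; rewrite /flow_line /= -!actD addrC.
exact: flow_line_smooth.
Unshelve. all: by end_near. Qed.

Lemma act_periodic r : act (1 + r) = act r.
Proof. by apply/funext => q; rewrite actD act1. Qed.

Section Average.
Variable tau : field1 P.
Hypothesis tau_form : form1 tau.
Hypothesis tau_closed : forall q u v, ext1 tau q u v = 0.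

Definition average : field1 P := fun q v => mean (fun r => tau (act r q) (tangent (act r) q v)).

Local Notation slice q w := (pull1 (act_chart q) tau w).

Lemma slice_smooth q w z : img q z.2 -> smooth_at (slice q w) z.
Proof. by case: z => r y qy; apply: smooth_pull1 => //; exact: act_chart_smooth. Qed.

Lemma slice_continuous q w y : img q y -> continuous (fun r : R => slice q w (r : R^o, y) : R).
Proof.
move=> qy; apply: (@continuous_slice _ _ _ (img q)) => // z qz.
by apply: smooth_at_continuous; exact: slice_smooth.
Qed.

Lemma slice_space q u (r : R) y : img q y -> slice q (0, u) (r : R^o, y) =
  tau (act r (chart_inv (chart_at q) y))
      (tangent (act r) (chart_inv (chart_at q) y) (frame (chart_at q) y u)).
Proof. by move=> qy; rewrite /pull1 dmap_act_chart_space. Qed.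

Lemma orbit_continuous q v :
  continuous (fun r : R => tau (act r q) (tangent (act r) q v) : R).
Proof.
have := @slice_continuous q (0 : R^o, v) _ (coord_img q).
have E1 r : slice q (0, v) (r : R^o, coord q) = tau (act r q) (tangent (act r) q v).
  rewrite (slice_space v r (coord_img q)) chart_inv_coord; congr (tau _ (tangent _ _ _)).
  exact: dmap_chart_inv.
by under eq_fun do rewrite E1.
Qed.

Lemma average_linear q a u v : average q (a *: u + v) = a * average q u + average q v.
Proof.
rewrite /average -mean_linear; [|exact: orbit_continuous|exact: orbit_continuous].
congr mean; apply/funext => r.
by rewrite (tangent_linear (act r) q) (tau_form I).1.
Qed.

Lemma comp1_average q u y : img q y ->
  comp1 (chart_at q) average u y = mean (fun r => slice q (0, u) (r : R^o, y)).
Proof.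
by move=> qy; rewrite /comp1 /average; congr mean; apply/funext => r; rewrite slice_space.
Qed.

Lemma img_open (q : P) : open (img q). Proof. exact: chart_img_open. Qed.

Lemma slice_Ck q w k : Ck k [set z | img q z.2] (slice q w).
Proof. by apply: smooth_on_Ck => z; exact: slice_smooth. Qed.

Lemma average_form : form1 average.
Proof.
move=> q _; split=> [a u v|u]; first exact: average_linear.
have sm : smooth_at (fun y => mean (fun r => slice q (0, u) (r : R^o, y)) : R^o) (coord q).
  exists (img q); first by split; [exact: img_open|exact: coord_img].
  move=> k; apply: (@Ck_mean _ _ _ k (slice q (0, u))); last exact: slice_Ck.
    exact: finite_coords_rV.
  exact: img_open.
apply: near_eq_smooth sm.
by apply: filterS (near_chart_img (coord_img q)) => y qy; rewrite comp1_average.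
Qed.

Lemma derive_mean_slice q w y u : img q y ->
  'D_u (fun y => mean (fun r => slice q w (r : R^o, y)) : R^o) y =
  mean (fun r => 'D_(0, u) (slice q w) (r : R^o, y)).
Proof.
move=> qy.
have [d dE] := diff_mean (finite_coords_rV n) (@img_open q) (slice_Ck q w 1) qy.
by rewrite deriveE.
Qed.

Lemma derive_slice_continuous q w w' y : img q y ->
  continuous (fun r : R => 'D_w' (slice q w) (r : R^o, y) : R).
Proof.
move=> qy; apply: (@continuous_slice _ _ ('D_w' (slice q w)) (img q)) => // z qz.
by apply: smooth_at_continuous; apply: smooth_at_derive; exact: slice_smooth.
Qed.

(** Constant vector fields commute, so closedness of tau says that the derivatives
    in the directions w and w' can be exchanged. *)
Lemma slice_closed q w w' (r : R) y : img q y ->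
  'D_w' (slice q w) (r : R^o, y) = 'D_w (slice q w') (r : R^o, y).
Proof.
move=> qy; apply/eqP; rewrite -subr_eq0 (ext1_pull1 w' w (act_chart_smooth r qy) tau_form).
by rewrite tau_closed.
Qed.

(** The differentiation under the mean reduces the claim to the closedness of tau
    along the orbit. *)
Lemma average_closed q u v : ext1 average q u v = 0.
Proof.
have nE w : \forall y \near coord q, comp1 (chart_at q) average w y =
    mean (fun r => slice q (0, w) (r : R^o, y)) :> R^o.
  by apply: filterS (near_chart_img (coord_img q)) => y qy; rewrite comp1_average.
have cq := coord_img q.
rewrite /ext1 (near_eq_derive u (nE v)) (near_eq_derive v (nE u)) !derive_mean_slice//.
apply/eqP; rewrite subr_eq0; apply/eqP; congr mean; apply/funext => r.
exact: slice_closed.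
Qed.

Definition period q := mean (fun r => tau (act r q) (generator act (act r q))).

Lemma average_generator q : average q (generator act q) = period q.
Proof.
by rewrite /average /period; congr mean; apply/funext => r; rewrite tangent_generator.
Qed.

Lemma period_slice q y : img q y ->
  period (chart_inv (chart_at q) y) = mean (fun r => slice q (1, 0) (r : R^o, y)).
Proof.
by move=> qy; rewrite /period; congr mean; apply/funext => r; rewrite /pull1 dmap_act_chart_flow.
Qed.

(** By [slice_closed] the derivative is the mean of the derivative in time of a
    function of period 1. *)
Lemma derive_period q y u : img q y ->
  'D_u (fun y => mean (fun r => slice q (1, 0) (r : R^o, y)) : R^o) y = 0.
Proof.
move=> qy; rewrite derive_mean_slice//.
have -> : (fun r => 'D_(0, u) (slice q (1, 0)) (r : R^o, y) : R) =
          (fun r => 'D_(1, 0) (slice q (0, u)) (r : R^o, y)).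
  by apply/funext => r; exact: slice_closed.
have E1 (r : R) : r *: ((1, 0) : R^o * 'rV[R]_n) + (0, y) = (r : R^o, y).
  by congr pair; rewrite /= ?scaler0 ?add0r// addr0 /GRing.scale /= mulr1.
have -> : mean (fun r => 'D_(1, 0) (slice q (0, u)) (r : R^o, y)) =
    slice q (0, u) (1 : R^o, y) - slice q (0, u) (0 : R^o, y).
  apply: (@mean_antiderivative _ _ (fun r => slice q (0, u) (r : R^o, y))).
    exact: derive_slice_continuous.
  move=> r _.
  have sr : differentiable (slice q (0, u)) (r : R^o, y).
    by apply: smooth_at_diff; exact: slice_smooth.
  rewrite -E1 in sr.
  have E2 : (fun s : R^o => slice q (0, u) (s *: ((1, 0) : R^o * 'rV[R]_n) + (0, y))) =
            (fun s : R^o => slice q (0, u) (s, y)).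
    by apply/funext => s; rewrite E1.
  have D := @is_derive_line R (R^o * 'rV[R]_n)%type R^o (slice q (0, u)) (0, y) (1, 0) r sr.
  rewrite E2 in D.
  rewrite E1 in D.
  exact: D.
rewrite (slice_space u 1 qy) (slice_space u 0 qy) -[X in act X]addr0 act_periodic.
by rewrite subrr.
Qed.

Lemma period_locally_constant q : \forall q' \near q, period q' = period q.
Proof.
pose C y : R^o := mean (fun r => slice q (1, 0) (r : R^o, y)).
have Cd y : img q y -> differentiable C y.
  by move=> qy; have [] := diff_mean (finite_coords_rV n) (@img_open q) (slice_Ck q (1, 0) 1) qy.
have Cloc : \forall y \near coord q, C y = C (coord q).
  apply: filterS (near_star_shaped (near_chart_img (coord_img q))) => y seg.
  have [t t01] := mean_value (fun t t01 => Cd _ (seg t t01)).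
  rewrite derive_period; last exact: seg.
  by rewrite subrK => /eqP; rewrite subr_eq0 => /eqP.
have dq := mem_chart_at q.
apply: filterS2 (near_comp (chart_fun_continuous dq) Cloc) (near_chart_dom dq) => q' Cq' dq'.
have imq' : img q (chart_fun (chart_at q) q') by exists q'.
have e : chart_inv (chart_at q) (chart_fun (chart_at q) q') = q' by exact: chart_funK.
have E1 := period_slice imq'; rewrite e in E1.
have E2 := period_slice (coord_img q); rewrite chart_inv_coord in E2.
rewrite E1 E2; exact: Cq'.
Qed.

End Average.
End CircleAction.

(** * A closed form transverse to the fibres makes the curvature exact *)
Section TransverseForm.
Context {R : realType}.

Lemma kernel_line n (L : {linear 'rV[R]_n.+1 -> 'rV[R]_n})
    (S : {linear 'rV[R]_n -> 'rV[R]_n.+1}) (X w : 'rV[R]_n.+1) :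
  (forall v, L (S v) = v) -> X != 0 -> L X = 0 -> L w = 0 -> exists a, w = a *: X.
Proof.
move=> LS X0 LX Lw; pose A := lin1_mx L.
have Afull : \rank A = n.
  apply/eqP; apply/row_fullP; exists (lin1_mx S).
  by apply/row_matrixP => i; rewrite row1 row_mul rowE mul_rV_lin1 mul_rV_lin1 LS.
have inK v : L v = 0 -> (v <= kermx A)%MS by move=> Lv; apply/sub_kermxP; rewrite mul_rV_lin1.
have XK : (X == kermx A)%MS.
  by rewrite -(mxrank_leqif_eq (inK X LX)) mxrank_ker Afull subSnn rank_rV X0.
have : (w <= X)%MS by rewrite (eqmxP XK); exact: inK.
by move=> /sub_rVP.
Qed.

Lemma ext1_linear n (N : manifold R n) (a : R) (s t : field1 N) x u v :
  form1 s -> form1 t ->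
  ext1 (fun x v => a * s x v + t x v) x u v = a * ext1 s x u v + ext1 t x u v.
Proof.
move=> fs ft; rewrite /ext1.
have D w z : 'D_w (comp1 (chart_at x) (fun x v => a * s x v + t x v) z) (coord x) =
   a * 'D_w (comp1 (chart_at x) s z) (coord x) + 'D_w (comp1 (chart_at x) t z) (coord x).
  have ds : differentiable (comp1 (chart_at x) s z) (coord x).
    by apply: smooth_at_diff; exact: (fs x I).2.
  have dt : differentiable (comp1 (chart_at x) t z) (coord x).
    by apply: smooth_at_diff; exact: (ft x I).2.
  rewrite -[comp1 _ _ _ in LHS]/(a *: comp1 (chart_at x) s z + comp1 (chart_at x) t z).
  rewrite deriveD; [|exact: diff_derivable (differentiableZ _ ds)|exact: diff_derivable].
  by rewrite deriveZ; [|exact: diff_derivable].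
rewrite !D; ring.
Qed.

Lemma form1_linear n (N : manifold R n) (a : R) (s t : field1 N) :
  form1 s -> form1 t -> form1 (fun x v => a * s x v + t x v).
Proof.
move=> fs ft x _; split=> [b u v|u].
  by rewrite (fs x I).1 (ft x I).1; ring.
apply: (@smooth_atD _ _ _ (fun y => a * comp1 (chart_at x) s u y : R^o)); last exact: (ft x I).2.
by apply: smooth_atM; [exact: smooth_at_cst|exact: (fs x I).2].
Qed.

Lemma form1_opp n (N : manifold R n) (t : field1 N) : form1 t ->
  form1 (fun x v => - t x v) /\
  forall x u v, ext1 (fun x v => - t x v) x u v = - ext1 t x u v.
Proof.
move=> ft; pose z : field1 N := fun _ _ => 0.
have fz : form1 z.
  by move=> x _; split=> [a u v|u]; [rewrite mulr0 addr0|exact: smooth_at_cst].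
have -> : (fun x v => - t x v) = (fun x v => -1 * t x v + z x v) :> field1 N.
  by apply/funext => x; apply/funext => v; rewrite mulN1r addr0.
split=> [|x u v]; first exact: form1_linear.
rewrite ext1_linear// mulN1r [X in _ + X](_ : _ = 0) ?addr0//.
by rewrite /ext1 /comp1 !derive_cst subrr.
Qed.

Context {n : nat} {P : manifold R n.+1} {M : manifold R n}.
Variables (p : P -> M) (act : R -> P -> P).
Hypothesis bundle : circle_bundle p act.

Let act_smooth : smooth_action act. Proof. by case: bundle => -[]. Qed.
Let p_smooth q : smooth_map_at p q. Proof. by case: bundle => -[]. Qed.
Let act0 q : act 0 q = q. Proof. by case: bundle => _ []. Qed.
Let actD s t q : act (s + t) q = act s (act t q). Proof. by case: bundle => _ []. Qed.
Let act1 q : act 1 q = q.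
Proof. by case: bundle => _ _ /(_ 1 q) [_ H] _ _; apply: H; exact: int_num1. Qed.

Lemma p_act t q : p (act t q) = p q.
Proof. by case: bundle => _ _ _ /(_ q (act t q)) [_ H] _; apply/esym; apply: H; exists t. Qed.

Lemma same_fibre q q' : p q = p q' -> exists t, q' = act t q.
Proof. by case: bundle => _ _ _ /(_ q q') [H _] _. Qed.

Lemma tangent_p_act t q v : tangent p (act t q) (tangent (act t) q v) = tangent p q v.
Proof.
rewrite -(tangent_comp v (act_smooth_map act_smooth t q) (p_smooth _)).
apply: tangent_near_eq; last exact: p_smooth.
by near=> q'; rewrite /= p_act.
Unshelve. all: by end_near. Qed.

Lemma tangent_p_generator q : tangent p q (generator act q) = 0.
Proof.
rewrite (generatorE act_smooth act0).
have E1 : flow_line act q 0 = q by rewrite /flow_line act0.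
have := @dmap_map _ _ _ _ _ _ p (flow_line act q) 0 1 (flow_line_smooth act_smooth q 0) (p_smooth _).
rewrite E1 => <-.
have cst_smooth : smooth_to (fun=> p q : M) (0 : R^o).
  by split; [exact: cvg_cst|exact: smooth_at_cst].
rewrite (@dmap_near_eq _ _ _ _ (fun=> p q)) //; last by near=> r; rewrite /flow_line /= p_act.
by rewrite /dmap -[_ \o _]/(fun=> chart_fun (chart_at (p q)) (p q)) diff_cst.
Unshelve. all: by end_near. Qed.

Definition section_at (s : M -> P) (x : M) :=
  smooth_map_at s x /\ \forall x' \near x, p (s x') = x'.

Lemma tangent_section s x v : section_at s x -> tangent p (s x) (tangent s x v) = v.
Proof.
move=> [ss ps]; rewrite -(tangent_comp v ss (p_smooth _)).
rewrite (tangent_near_eq v _ (smooth_map_id x)) ?tangent_id//.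
by apply: filterS ps => x' /= ->.
Qed.

Lemma local_sections : exists (s : M -> M -> P), forall b : M,
  \forall x \near b, section_at (s b) x.
Proof.
case: bundle => _ _ _ _ sec.
have ex_s (b : M) : exists s : M -> P, \forall x \near b, section_at s x.
  have [U [oU Ub] [s sP]] := sec b; exists s.
  near=> x; have Ux : U x by near: x; exact: open_nbhs_nbhs.
  split; first exact: (sP x Ux).1.
  near=> x'; apply: (sP x' _).2; near: x'; exact: open_nbhs_nbhs.
by exists (fun b => projT1 (cid (ex_s b))) => b; exact: projT2 (cid (ex_s b)).
Unshelve. all: by end_near. Qed.

Lemma section_through q : exists s, section_at s (p q) /\ s (p q) = q.
Proof.
have [s sP] := local_sections.
have [ss ps] := nbhs_singleton (sP (p q)).
have [t qE] := @same_fibre (s (p q) (p q)) q (nbhs_singleton ps).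
exists (act t \o s (p q)); split=> //; split.
  by apply: smooth_map_comp => //; exact: act_smooth_map.
by apply: filterS ps => x /= {2}<-; rewrite p_act.
Qed.

(** The projection is submersive because it has a section through q, so its
    kernel is a line. *)
Lemma vertical_generator q w : generator act q != 0 ->
  tangent p q w = 0 -> exists a, w = a *: generator act q.
Proof.
move=> X0 pw; have [s [sP sq]] := section_through q.
pose L := linear_map (tangent_linear p q).
pose S := linear_map (tangent_linear s (p q)).
apply: (@kernel_line _ L S) => //; last exact: tangent_p_generator.
by move=> v; have := tangent_section v sP; rewrite sq.
Qed.

(** Invariant forms that vanish on the fibres. *)
Definition basic_form (eta : field1 P) :=
  (forall q, eta q (generator act q) = 0) /\
  (forall t q v, eta (act t q) (tangent (act t) q v) = eta q v).

Hypothesis generator_neq0 : forall q, generator act q != 0.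

(** The two sections differ at x by the action of some t, and the vectors that they
    produce differ, after transport by t, by a vertical vector. *)
Lemma basic_sections (eta : field1 P) s1 s2 x v : form1 eta -> basic_form eta ->
  section_at s1 x -> section_at s2 x ->
  eta (s1 x) (tangent s1 x v) = eta (s2 x) (tangent s2 x v).
Proof.
move=> feta [etaX eta_inv] sec1 sec2.
have px1 := nbhs_singleton sec1.2; have px2 := nbhs_singleton sec2.2.
have [t tE] : exists t, s2 x = act t (s1 x) by apply: same_fibre; rewrite px1 px2.
have [a aE] : exists a, tangent (act t) (s1 x) (tangent s1 x v) - tangent s2 x v
    = a *: generator act (s2 x).
  apply: vertical_generator; first exact: generator_neq0.
  have lp := linearB (linear_map (tangent_linear p (s2 x))).
  rewrite [LHS]lp /= {1}tE tangent_p_act (tangent_section v sec1) (tangent_section v sec2).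
  by rewrite subrr.
rewrite -(eta_inv t) -tE.
have -> : tangent (act t) (s1 x) (tangent s1 x v) =
    a *: generator act (s2 x) + tangent s2 x v by rewrite -aE subrK.
by rewrite (feta (s2 x) I).1 etaX mulr0 add0r.
Qed.

(** The form on M is defined through local sections, which all give the same value
    by [basic_sections]. *)
Lemma basic_descends (eta : field1 P) (Omega : field2 M) :
  form1 eta -> basic_form eta -> pullback2 p Omega = ext1 eta -> exact_form2 Omega.
Proof.
move=> feta beta etaE; have [s sP] := local_sections.
pose beta_ : field1 M := fun x v => eta (s x x) (tangent (s x) x v).
have loc x : \forall x' \near x, smooth_map_at (s x) x' /\
    forall v, beta_ x' v = eta (s x x') (tangent (s x) x' v).
  apply: filterS (sP x) => x' sec; split; first exact: sec.1.
  move=> v; apply: basic_sections => //; exact: nbhs_singleton (sP x').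
exists beta_; split.
  move=> x _; split=> [a u v|u]; last exact: (pullback_local feta (loc x)).1.
  by rewrite /beta_ (tangent_linear (s x) x) (feta _ I).1.
apply/funext => x; apply/funext => u; apply/funext => v.
have sec := nbhs_singleton (sP x).
rewrite (pullback_local feta (loc x)).2 -etaE /pullback2 !(tangent_section _ sec).
by rewrite (nbhs_singleton sec.2).
Qed.

Lemma transverse_closed_form_exact (psi tau : field1 P) (Omega : field2 M) :
  (forall q q' : P, exists gam : R -> P, [/\ continuous gam, gam 0 = q & gam 1 = q']) ->
  [set: P] !=set0 ->
  connection_form act psi -> pullback2 p Omega = (fun q u v => - ext1 psi q u v) ->
  form1 tau -> (forall q u v, ext1 tau q u v = 0) ->
  (forall q, 0 < tau q (generator act q)) ->
  exact_form2 Omega.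
Proof.
move=> Pconn [q0 _] [fpsi psi_inv psiX] OmegaE ftau tau_closed tau_pos.
pose c := period act tau q0.
have cE q : period act tau q = c.
  have [gam [gamc g0 g1]] := Pconn q0 q.
  have := @locally_constant_segment R (fun t => period act tau (gam t) = c) 0 1 ler01.
  rewrite g0 g1; apply=> // t _.
  have := near_comp (gamc t) (period_locally_constant act_smooth act0 actD act1 ftau tau_closed (gam t)).
  by apply: filterS => t' ->.
have c0 : 0 < c.
  have oc : continuous (fun r : R => tau (act r q0) (tangent (act r) q0 (generator act q0)) : R).
    exact: orbit_continuous.
  rewrite /c -(average_generator act_smooth act0 actD).
  apply: mean_gt0 => // r; rewrite (tangent_generator act_smooth act0 actD).
  exact: tau_pos.
pose avg := average act tau.
have favg : form1 avg by exact: average_form.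
have [fnpsi dnpsi] := form1_opp fpsi.
pose eta : field1 P := fun q v => c^-1 * avg q v + (- psi q v).
have feta : form1 eta by exact: form1_linear.
apply: (@basic_descends eta) => //.
- split=> [q|t q v].
    rewrite /eta /avg (average_generator act_smooth act0 actD) cE psiX.
    by rewrite mulVf ?gt_eqF// subrr.
  rewrite /eta psi_inv; congr (_ * _ + _).
  rewrite /avg /average.
  pose g (r : R) : R := tau (act r q) (tangent (act r) q v).
  have gc : continuous g by exact: orbit_continuous.
  rewrite -/(mean g) -(mean_shift t gc); last first.
    by move=> r; rewrite /g (act_periodic actD act1).
  congr mean; apply/funext => r; rewrite /g {1}actD; congr (tau _ _).
  rewrite -(tangent_comp v (act_smooth_map act_smooth t q) (act_smooth_map act_smooth r _)).
  have -> : act r \o act t = act (r + t) by apply/funext => q'; rewrite /= actD.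
  exact: erefl.
- rewrite OmegaE; apply/funext => q; apply/funext => u; apply/funext => v.
  by rewrite /eta ext1_linear// dnpsi /avg average_closed// mulr0 add0r.
Qed.

End TransverseForm.

(** * Inner products and dual norms *)
Section Metrics.
Context {R : realType}.

Definition inner_product n (g : 'rV[R]_n -> 'rV[R]_n -> R) :=
  [/\ forall a u v w, g (a *: u + v) w = a * g u w + g v w,
      forall u v, g u v = g v u & forall u, u != 0 -> 0 < g u u].

Lemma entry_le_norm n (v : 'rV[R]_n) i : `|v ord0 i| <= `|v|.
Proof. by rewrite [leRHS]/Num.Def.normr/= mx_normrE; exact: (le_bigmax _ _ (ord0, i)). Qed.

Lemma bilinear_expand n (g : 'rV[R]_n -> 'rV[R]_n -> R) :
  (forall a u v w, g (a *: u + v) w = a * g u w + g v w) ->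
  (forall u v, g u v = g v u) ->
  forall u, g u u = \sum_i \sum_j u ord0 i * u ord0 j * g (delta_mx ord0 i) (delta_mx ord0 j).
Proof.
move=> gl gs u; rewrite {1}(linear_sum_coords (f := g ^~ u))//.
apply: eq_bigr => i _; rewrite gs.
rewrite (linear_sum_coords (f := g ^~ (delta_mx ord0 i)))// mulr_sumr.
by apply: eq_bigr => j _; rewrite gs mulrA.
Qed.

Lemma inner_product0 n (g : 'rV[R]_n -> 'rV[R]_n -> R) : inner_product g -> g 0 0 = 0.
Proof. by move=> [gl _ _]; apply: (linear_fun0 (f := g ^~ 0)) => a u v; exact: gl. Qed.

Lemma inner_productZ n (g : 'rV[R]_n -> 'rV[R]_n -> R) (a : R) u : inner_product g ->
  g (a *: u) (a *: u) = a ^+ 2 * g u u.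
Proof.
move=> [gl gs _].
have g0 w : g 0 w = 0 by apply: (linear_fun0 (f := g ^~ w)) => b x y; exact: gl.
have gZl b x w : g (b *: x) w = b * g x w by have := gl b x 0 w; rewrite addr0 g0 addr0.
by rewrite gZl gs gZl mulrA -expr2.
Qed.

Lemma inner_product_ge0 n (g : 'rV[R]_n -> 'rV[R]_n -> R) u :
  inner_product g -> 0 <= g u u.
Proof.
move=> ig; have [->|u0] := eqVneq u 0; first by rewrite inner_product0.
by have [_ _ gp] := ig; exact/ltW/gp.
Qed.

(** The constant is the minimum of g on the unit sphere, which is compact. *)
Lemma inner_product_coercive n (g : 'rV[R]_n -> 'rV[R]_n -> R) :
  inner_product g -> exists2 c : R, 0 < c & forall u, c * `|u| ^+ 2 <= g u u.
Proof.
move=> ig; have [gl gs gp] := ig.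
have g0 := inner_product0 ig; have gZ a u := inner_productZ a u ig.
have [[u0 u00]|nou] := pselect (exists u : 'rV[R]_n, u != 0); last first.
  exists 1 => // u; have -> : u = 0 by apply: contrapT => /eqP u0; apply: nou; exists u.
  by rewrite normr0 expr0n mulr0 g0.
pose A := [set u : 'rV[R]_n | `|u| = 1].
have unit u : u != 0 -> A (`|u|^-1 *: u).
  by move=> u1; rewrite /A /= normrZ normfV normr_id mulVf// normr_eq0.
have gc : continuous (fun u => g u u : R).
  have sid u i : smooth_at (fun u : 'rV[R]_n => u ord0 i : R^o) u.
    by apply: (smooth_at_linear (L := linear_map (coord_fun_linear i))); exact: coord_continuous.
  move=> u; apply: (near_eq_continuous (f := fun u : 'rV[R]_n =>
      \sum_i \sum_j u ord0 i * u ord0 j * g (delta_mx ord0 i) (delta_mx ord0 j) : R^o)).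
    by near=> w; rewrite [RHS]bilinear_expand.
  apply: smooth_at_continuous; apply: smooth_at_sum => i; apply: smooth_at_sum => j.
  apply: smooth_atM; last exact: smooth_at_cst.
  by apply: smooth_atM; exact: sid.
have Ac : compact A.
  apply: bounded_closed_compact.
    exists 1; split; first exact: num_real.
    by move=> M M1 u; rewrite /A /= => ->; exact: ltW.
  rewrite (_ : A = (fun u : 'rV[R]_n => `|u|) @^-1` [set 1])//.
  by apply: closed_comp => [u _|]; [exact: norm_continuous|exact: closed_eq].
have [] := @EVT_min_rV R n (fun u => g u u) A.
- by exists (`|u0|^-1 *: u0); exact: unit.
- exact: Ac.
- exact: continuous_subspaceT.
move=> w; rewrite inE => wA wmin.
have w0 : w != 0 by rewrite -normr_eq0 wA oner_eq0.
exists (g w w); first exact: gp.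
move=> u; have [->|u1] := eqVneq u 0; first by rewrite normr0 expr0n mulr0 g0.
have := wmin (`|u|^-1 *: u); rewrite inE => /(_ (unit u u1)).
by rewrite gZ exprVn mulrC ler_pdivlMr// exprn_gt0// normr_gt0.
Unshelve. all: by end_near. Qed.

(** Without this bound the supremum that defines the dual norm would be 0 by
    convention and would not control the functional. *)
Lemma functional_bounded n (g : 'rV[R]_n -> 'rV[R]_n -> R) (a : 'rV[R]_n -> R) :
  inner_product g -> (forall b u v, a (b *: u + v) = b * a u + a v) ->
  exists K : R, forall v, g v v <= 1 -> `|a v| <= K.
Proof.
move=> /inner_product_coercive[c c0 cg] al.
have al' : linear (a : 'rV[R]_n -> R^o) by exact: al.
have alc : continuous (linear_map al').
  by apply: linear_continuous_coords; exact: finite_coords_rV.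
have [k k0 ak] := linear_lipschitz alc.
exists (k * (c^-1 + 1)) => v gv.
apply: le_trans (ak v) _; rewrite ler_pM2l//.
have v2 : `|v| ^+ 2 <= c^-1.
  by rewrite -[leRHS]mulr1 ler_pdivlMl// (le_trans (cg v)).
have := sqr_ge0 (`|v| - 1); have := normr_ge0 v; nra.
Qed.

Variables (n : nat) (N : manifold R n).

Lemma dual_norm_ge (g : field2 N) x (a : 'rV[R]_n -> R) v :
  inner_product (g x) -> (forall b u v, a (b *: u + v) = b * a u + a v) ->
  g x v v <= 1 -> `|a v| <= dual_norm g x a.
Proof.
move=> gx al gv; have [K aK] := functional_bounded gx al.
apply: ub_le_sup; last by exists v.
by exists K => _ [w /= gw <-]; exact: aK.
Qed.

Lemma dual_norm_le (g : field2 N) x (a : 'rV[R]_n -> R) (C : R) :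
  g x 0 0 <= 1 -> (forall v, g x v v <= 1 -> `|a v| <= C) -> dual_norm g x a <= C.
Proof.
move=> g0 aC; apply: ge_sup; first by exists `|a 0|; exists 0.
by move=> _ [w /= gw <-]; exact: aC.
Qed.

Lemma dual_norm_ge0 (g : field2 N) x (a : 'rV[R]_n -> R) : 0 <= dual_norm g x a.
Proof.
rewrite /dual_norm; set S := [set _ | _ in _].
have [[[y [w gw yE]] Sub]|noS] := pselect (has_sup S); last by rewrite sup_out.
by apply: le_trans (ub_le_sup Sub _); last by exists w; [exact: gw|]; rewrite ?normr_ge0.
Qed.

Lemma dual_norm_scale (g : field2 N) x (a : 'rV[R]_n -> R) v (s : R) :
  inner_product (g x) -> (forall b u v, a (b *: u + v) = b * a u + a v) ->
  0 < s -> g x v v <= s ^+ 2 -> `|a v| <= s * dual_norm g x a.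
Proof.
move=> gx al s0 gs.
have aZ b u : a (b *: u) = b * a u.
  by have := al b u 0; rewrite addr0 (linear_fun0 al) addr0.
have gw : g x (s^-1 *: v) (s^-1 *: v) <= 1.
  by rewrite inner_productZ// exprVn mulrC ler_pdivrMr ?mul1r// exprn_gt0.
have := dual_norm_ge gx al gw.
by rewrite aZ normrM gtr0_norm ?invr_gt0// mulrC ler_pdivrMr// mulrC.
Qed.


End Metrics.

(** * Comparison of two metrics on a compact manifold *)
Section MetricComparison.
Context {R : realType} {n : nat} {M : manifold R n}.

Lemma frame_surjective (x : M) y v :
  (chart_fun (chart_at x) @` chart_dom (chart_at x)) y ->
  exists u, frame (chart_at x) y u = v.
Proof.
move=> yimg; pose z := chart_inv (chart_at x) y; set c := chart_at x; pose Psi := chart_inv (chart_at z).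
have cz : chart_dom c z by have [w cw wE] := yimg; rewrite /z -wE chart_funK.
have zE : Psi (coord z) = z by exact: chart_inv_coord.
have [Psic _] := chart_inv_smooth (coord_img z).
have fz : chart_fun c (Psi (coord z)) = y by rewrite zE; exact: chart_invK.
have sf : smooth_at (chart_fun c \o Psi) (coord z).
  by apply: chart_compat => //; exact: mem_chart_at.
have sPhi : smooth_to (chart_inv c) ((chart_fun c \o Psi) (coord z)).
  by rewrite /= fz; exact: chart_inv_smooth.
exists ('d (chart_fun c \o Psi) (coord z) v).
have E1 := dmap_comp v sf sPhi.
rewrite /= fz in E1; rewrite -[LHS]E1 -[RHS](dmap_chart_inv z).
apply: dmap_near_eq; last exact: chart_inv_smooth (coord_img z).
have cz' : chart_dom c (Psi (coord z)) by rewrite zE.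
exact: near_through_chart Psic cz'.
Qed.

Lemma metric_inner_product (g : field2 M) x : riemannian_metric g -> inner_product (g x).
Proof. by move=> /(_ x)[gl gs gp _]; split=> // a u v w; exact: gl. Qed.

(** In a chart the entries of both metrics are continuous, so h stays coercive and k
    stays bounded near x. *)
Lemma metric_comparison_local (k h : field2 M) (x : M) :
  riemannian_metric k -> riemannian_metric h ->
  exists K : R, \forall x' \near x, forall v, k x' v v <= K * h x' v v.
Proof.
move=> km hm; set c := chart_at x.
pose e (i : 'I_n) : 'rV[R]_n := delta_mx ord0 i.
pose B := (\sum_(i < n) \sum_(j < n) 1 : R).
have expand (g : field2 M) u y : riemannian_metric g -> comp2 c g u u y =
    \sum_i \sum_j u ord0 i * u ord0 j * comp2 c g (e i) (e j) y.
  move=> gm; have [gl gs _] := metric_inner_product (chart_inv c y) gm.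
  apply: (bilinear_expand (g := fun u v => comp2 c g u v y)) => [a w z t|w z].
    by rewrite /comp2 -gl; congr (g _ _ _); exact: dmap_linear.
  exact: gs.
have near_entries (g : field2 M) (d : R) : 0 < d -> riemannian_metric g ->
    \forall y \near coord x, forall u, `|comp2 c g u u y - comp2 c g u u (coord x)| <= B * d * `|u| ^+ 2.
  move=> d0 gm; have [_ _ _ gs] := gm x.
  have : \forall y \near coord x, forall ij : 'I_n * 'I_n,
      `|comp2 c g (e ij.1) (e ij.2) (coord x) - comp2 c g (e ij.1) (e ij.2) y| <= d.
    apply: (@filter_forall _ _ (fun ij y => `|comp2 c g (e ij.1) (e ij.2) (coord x) -
      comp2 c g (e ij.1) (e ij.2) y| <= d) (nbhs (coord x))) => -[i j].
    by have /cvgrPdist_le/(_ _ d0) := smooth_at_continuous (gs (e i) (e j)).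
  apply: filterS => y yd u; rewrite !expand// -sumrB /B !mulr_suml.
  apply: le_trans (ler_norm_sum _ _ _) _; apply: ler_sum => i _.
  rewrite -sumrB.
  apply: le_trans (ler_norm_sum _ _ _) _; apply: ler_sum => j _.
  rewrite -mulrBr normrM mul1r mulrC distrC ler_pM//; first exact: (yd (i, j)).
  by rewrite normrM expr2 ler_pM// entry_le_norm.
have hx := metric_inner_product x hm; have [c0 c00 ch] := inner_product_coercive hx.
have at_x (g : field2 M) u : comp2 c g u u (coord x) = g x u u.
  by rewrite /comp2 /c chart_inv_coord; congr (g _ _ _); exact: dmap_chart_inv.
have B0 : 0 <= B by apply: sumr_ge0 => i _; exact: sumr_ge0.
have d0 : 0 < c0 / 2 / (B + 1) by rewrite !divr_gt0// ltr_wpDl.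
pose D := \sum_i \sum_j `|k x (e i) (e j)|.
have kx u : k x u u <= D * `|u| ^+ 2.
  have [kl ks _] := metric_inner_product x km.
  rewrite (bilinear_expand kl ks) /D mulr_suml; apply: ler_sum => i _.
  rewrite mulr_suml; apply: ler_sum => j _.
  apply: le_trans (ler_norm _) _; rewrite normrM mulrC ler_wpM2l//.
  by rewrite normrM expr2 ler_pM// entry_le_norm.
have D0 : 0 <= D by apply: sumr_ge0 => i _; exact: sumr_ge0.
pose K := (D + B) / (c0 / 2).
exists K.
have near_y : \forall y \near coord x, forall u, comp2 c k u u y <= K * comp2 c h u u y.
  apply: filterS2 (near_entries k 1 ltr01 km) (near_entries h _ d0 hm) => y ky hy u.
  have := ky u; have := hy u; rewrite !at_x mulr1.
  set hyu := comp2 c h u u y; set kyu := comp2 c k u u y => h1 k1.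
  have h2 : c0 / 2 * `|u| ^+ 2 <= hyu.
    have : B * (c0 / 2 / (B + 1)) * `|u| ^+ 2 <= c0 / 2 * `|u| ^+ 2.
      rewrite ler_wpM2r// ?sqr_ge0// mulrA ler_pdivrMr ?ltr_wpDl// mulrC.
      by rewrite ler_wpM2l ?lerDl// divr_ge0// ltW.
    have := ch u; move: h1; rewrite ler_norml => /andP[h1 _].
    set m := `|u| ^+ 2 in h1 *; set bb := B * _ * m in h1 *.
    by move=> H1 H2; lra.
  have k2 : kyu <= (D + B) * `|u| ^+ 2.
    by have := kx u; move: k1; rewrite ler_norml mulrDl => /andP[_ k1] H; lra.
  apply: (le_trans k2); rewrite /K -mulrA ler_wpM2l ?addr_ge0//.
  by rewrite mulrC ler_pdivlMr ?divr_gt0// mulrC.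
have cx := mem_chart_at x.
apply: filterS2 (near_comp (chart_fun_continuous cx) near_y) (near_chart_dom cx) => x' yx' dx' v.
have img' : (chart_fun c @` chart_dom c) (chart_fun c x') by exists x'.
have [u uE] := frame_surjective v img'.
have e1 : chart_inv c (chart_fun c x') = x' by exact: chart_funK.
by have := yx' u; rewrite /comp2 uE e1.
Qed.

Lemma metric_comparison (k h : field2 M) : compact [set: M] ->
  riemannian_metric k -> riemannian_metric h ->
  exists2 K : R, 0 < K & forall x v, k x v v <= K * h x v v.
Proof.
move=> /compact_near_coveringP cover km hm.
have : \forall K \near +oo, [set: M] `<=` (fun x => forall v, k x v v <= K * h x v v).
  apply: (cover R +oo (fun K x => forall v, k x v v <= K * h x v v)) => x _.
  have [K xK] := metric_comparison_local x km hm.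
  have near_K : \forall K' \near +oo, K <= K' by apply: nbhs_pinfty_ge; exact: num_real.
  exists ([set x' | forall v, k x' v v <= K * h x' v v], [set K' | K <= K']) => //.
  move=> [x' K'] [/= H1 H2] v; apply: le_trans (H1 v) _; apply: ler_wpM2r => //.
  by apply: inner_product_ge0; exact: metric_inner_product.
move=> H; have [K [K0 KP]] : exists K : R, 0 < K /\ ([set: M] `<=` (fun x => forall v, k x v v <= K * h x v v)).
  apply: (@filter_ex _ (+oo : set_system R)).
  by apply: filterI => //; apply: nbhs_pinfty_gt; exact: num_real.
by exists K => // x v; exact: KP.
Qed.

End MetricComparison.

(** * Lifting maps through coverings *)
Section PathLifting.
Context {R : realType}.

Definition clamp (t : R) : R := Num.max 0 (Num.min 1 t).

Lemma clamp0 : clamp 0 = 0.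
Proof. by rewrite /clamp min_r ?ler01// maxxx. Qed.

Lemma clamp1 : clamp 1 = 1.
Proof. by rewrite /clamp minxx max_r. Qed.

Lemma clamp01 t : 0 <= clamp t <= 1.
Proof. by rewrite /clamp le_max lexx ge_max ler01 ge_min lexx. Qed.

Lemma clamp_id t : 0 <= t <= 1 -> clamp t = t.
Proof. by move=> /andP[t0 t1]; rewrite /clamp min_r// max_r. Qed.

Lemma min_continuous (a : R) : continuous (fun t : R => Num.min a t).
Proof.
move=> t; apply: (continuous_min (f := fun=> a) (g := id)); first exact: cvg_cst.
exact: cvg_id.
Qed.

Lemma clamp_continuous : continuous clamp.
Proof.
move=> t; have c0 : {for t, continuous (fun=> 0 : R^o)} by exact: cvg_cst.
have c1 : {for t, continuous (fun t : R => Num.min 1 t : R^o)} by exact: min_continuous.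
exact: (continuous_max c0 c1).
Qed.

Lemma continuous_glue (T : topologicalType) (a b : R -> T) (c : R) :
  a c = b c -> (forall t, t <= c -> {for t, continuous a}) ->
  (forall t, c <= t -> {for t, continuous b}) ->
  continuous (fun t => if t <= c then a t else b t).
Proof.
move=> ab ac bc t; have [tc|ct|tc] := ltgtP t c.
- apply: (near_eq_continuous (f := a)); last by apply: ac; exact: ltW.
  by near=> t'; rewrite ifT//; apply: ltW; near: t'; exact: lt_nbhsl.
- apply: (near_eq_continuous (f := b)); last by apply: bc; exact: ltW.
  by near=> t'; rewrite leNgt ifF//; apply/negbTE; rewrite negbK; near: t'; exact: lt_nbhsr.
- rewrite tc => W; rewrite /= lexx => Wa.
  have Wb : nbhs (b c) W by rewrite -ab.
  have na : \forall t' \near c, W (a t') := ac c (lexx c) W Wa.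
  have nb : \forall t' \near c, W (b t') := bc c (lexx c) W Wb.
  apply: filterS2 na nb => t' /= Wa' Wb'.
  by case: ifP.
Unshelve. all: by end_near. Qed.

Variables (E B : topologicalType) (pr : E -> B).

(** V is a sheet over U: a clopen part of the preimage of U on which s inverts
    the projection. *)
Definition sheet (U : set B) (V : set E) (s : B -> E) :=
  [/\ open V,
      forall y, U y -> [/\ {for y, continuous s}, V (s y) & pr (s y) = y],
      forall x, V x -> U (pr x) /\ s (pr x) = x &
      forall x, U (pr x) -> ~ V x -> \forall x' \near x, ~ V x'].

Hypothesis sheets : forall b, exists2 U, open_nbhs b U &
  forall e, U (pr e) -> exists V s, sheet U V s /\ V e.

Lemma near_sheet U V s (g : R -> E) t : sheet U V s -> {for t, continuous g} ->
  U (pr (g t)) -> \forall t' \near t, V (g t') <-> V (g t).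
Proof.
move=> [oV _ _ nV] gc Ut; have [Vt|nVt] := pselect (V (g t)).
  have : \forall t' \near t, V (g t').
    by apply: near_comp => //; exact: open_nbhs_nbhs.
  by apply: filterS => t' Vt'; split.
have : \forall t' \near t, ~ V (g t') by apply: (near_comp (Q := fun x => ~ V x)) => //; exact: nV.
by apply: filterS => t' Vt'; split.
Qed.

(** A connected path over U cannot leave the clopen part V. *)
Lemma stay_in_sheet U V s (g : R -> E) a b : sheet U V s -> continuous g ->
  (forall t, Num.min a b <= t <= Num.max a b -> U (pr (g t))) -> V (g a) -> V (g b).
Proof.
move=> sV gc Ug; have [ab|/ltW ba] := leP a b.
  rewrite min_l// max_r// in Ug; apply: (@locally_constant_segment _ (fun t => V (g t)) a b ab).
  by move=> t tab; apply: near_sheet sV _ _; [exact: gc|exact: Ug].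
rewrite min_r// max_l// in Ug => Va; apply: contrapT => nVb; move: Va.
apply: (@locally_constant_segment _ (fun t => ~ V (g t)) b a ba) => //.
move=> t tab; have := near_sheet sV (gc t) (Ug t tab).
by apply: filterS => t' [H1 H2]; split; apply: contra_not.
Qed.

Lemma unique_lift (g1 g2 : R -> E) : continuous g1 -> continuous g2 ->
  (forall t, pr (g1 t) = pr (g2 t)) -> g1 0 = g2 0 -> g1 1 = g2 1.
Proof.
move=> c1 c2 pE.
apply: (@locally_constant_segment _ (fun t => g1 t = g2 t) 0 1 ler01) => t _.
have [U [oU Ub] /(_ _ Ub)[V [s [sV V1]]]] := sheets (pr (g1 t)).
have [oV sP Vs nV] := sV.
have near1 := near_sheet sV (c1 t) (Vs _ V1).1.
have U2 : U (pr (g2 t)) by rewrite -pE; exact: (Vs _ V1).1.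
have near2 := near_sheet sV (c2 t) U2.
apply: filterS2 near1 near2 => t' [_ /(_ V1) V1'] V2'; split=> [g12|g12].
  have V2 : V (g2 t) by apply: V2'.1; rewrite -g12.
  by rewrite -(Vs _ V1).2 pE (Vs _ V2).2.
have V2 : V (g2 t') by apply: V2'.2; rewrite -g12.
by rewrite -(Vs _ V1').2 pE (Vs _ V2).2.
Qed.

(** The set of T such that the path stopped at time T can be lifted is open and
    closed.  The lift is defined on the whole line, along the clamped path. *)
Lemma path_lifting (alpha : R -> B) (e : E) : continuous alpha -> pr e = alpha 0 ->
  exists g : R -> E, [/\ continuous g, g 0 = e & forall t, pr (g t) = alpha (clamp t)].
Proof.
move=> ac pe.
pose Q T := exists g : R -> E, [/\ continuous g, g 0 = e &
  forall t, pr (g t) = alpha (Num.max 0 (Num.min T t))].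
have Qneg T : T <= 0 -> Q T.
  move=> T0; exists (fun=> e); split=> // [|t]; first by move=> ?; exact: cvg_cst.
  by rewrite max_l// ge_min T0.
have Qdown T1 T2 : T2 <= T1 -> Q T1 -> Q T2.
  move=> T21 [g [gc g0 gE]]; have [/Qneg//|T20] := leP T2 0.
  exists (fun t => g (Num.min T2 t)); split.
  - move=> t; apply: (@continuous_comp _ _ _ (fun t => Num.min T2 t) g); last exact: gc.
    exact: min_continuous.
  - by rewrite min_r// ltW.
  - by move=> t; rewrite gE minA (min_r T21).
suff: Q 1 by [].
apply: (@locally_constant_segment _ Q 0 1 ler01); last exact: Qneg.
move=> T T01.
have [U [oU UT] lU] := sheets (alpha T).
have /nbhs_ballP[d /= d0 dU] : nbhs T (alpha @^-1` U) by apply: ac; exact: open_nbhs_nbhs.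
have step T1 T2 : ball T d T1 -> ball T d T2 -> Q T1 -> Q T2.
  have [T21|T12] := leP T2 T1; first by move=> _ _; exact: Qdown.
  have [/Qneg//|T20] := leP T2 0.
  wlog T10 : T1 T12 / 0 <= T1.
    have [T10|T10] := leP 0 T1; first by apply.
    move=> /(_ 0 T20 (lexx _)) H b1 b2 _; apply: H => //; last exact: Qneg.
    move: b1 b2 T01; rewrite -!ball_normE /ball_ /= !ltr_norml => /andP[? ?] /andP[? ?] /andP[? ?].
    by apply/andP; split; lra.
  move=> b1 b2 [g [gc g0 gE]].
  have g1E : pr (g T1) = alpha T1 by rewrite gE minxx max_r.
  have U1 : U (pr (g T1)) by rewrite g1E; exact: dU b1.
  have [V [s [[oV sP Vs _] V1]]] := lU _ U1.
  have Ut t : T1 <= t -> U (alpha (Num.min T2 t)).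
    move=> T1t; apply: dU; move: b1 b2; rewrite -!ball_normE /ball_ /= !ltr_norml.
    move=> /andP[? ?] /andP[? ?]; have [?|?] := leP T2 t; apply/andP; split; lra.
  exists (fun t => if t <= T1 then g t else s (alpha (Num.min T2 t))); split.
  - apply: continuous_glue.
    + by rewrite min_r ?ltW// -g1E (Vs _ V1).2.
    + by move=> t _; exact: gc.
    + move=> t T1t; apply: (@continuous_comp _ _ _ (alpha \o (fun t => Num.min T2 t)) s).
        by apply: continuous_comp; [exact: min_continuous|exact: ac].
      by have [] := sP _ (Ut t T1t).
  - by rewrite T10.
  - move=> t; have [tT1|T1t] := leP t T1.
      by rewrite gE !min_r// (le_trans tT1)// ltW.
    have [_ _ ->] := sP _ (Ut t (ltW T1t)).
    by rewrite [Num.max _ _]max_r// le_min ltW//= ltW// (le_lt_trans T10).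
near=> T'; have bT' : ball T d T' by near: T'; exact: nbhsx_ballx.
by split; apply: step => //; exact: ballxx.
Unshelve. all: by end_near. Qed.

(** The lifts depend continuously on s at every time, by connectedness in t; the
    endpoint then varies continuously in a fibre, where it is locally constant. *)
Lemma endpoint_locally_constant (F : R * R -> B) (g : R -> R -> E) (m0 : E) :
  continuous F -> (forall s, continuous (g s)) -> (forall s t, pr (g s t) = F (s, t)) ->
  (forall s, g s 0 = m0) -> (forall s, F (s, 1) = F (0, 1)) -> g 0 1 = g 1 1.
Proof.
move=> Fc gc gE g0 F1.
have Q1 s0 : {for s0, continuous (fun s => g s 1)}.
  apply: (@locally_constant_segment _ (fun T => {for s0, continuous (fun s => g s T)}) 0 1 ler01); last first.
    by apply: (near_eq_continuous (f := fun=> m0)); [near=> s; rewrite g0|exact: cvg_cst].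
  move=> T _.
  have [U [oU UT] /(_ _ UT)[V [sg [sV VT]]]] := sheets (pr (g s0 T)).
  have [oV sP Vs _] := sV.
  have : nbhs (s0, T) (F @^-1` U) by apply: Fc; apply: open_nbhs_nbhs; rewrite -gE.
  move=> [[N D] [/= Ns0 /nbhs_ballP[d /= d0 dD]] NDU].
  have conv T1 T2 t : ball T d T1 -> ball T d T2 ->
      Num.min T1 T2 <= t <= Num.max T1 T2 -> ball T d t.
    rewrite -!ball_normE /ball_ /= !ltr_norml => /andP[? ?] /andP[? ?].
    by have [?|?] := leP T1 T2; move=> /andP[? ?]; apply/andP; split; lra.
  have stay s T1 T2 : N s -> ball T d T1 -> ball T d T2 -> V (g s T1) -> V (g s T2).
    move=> Ns b1 b2; apply: stay_in_sheet sV (gc s) _ => t tT; rewrite gE.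
    by apply: (NDU (s, t)); split=> //; apply: dD; exact: conv tT.
  have step T1 T2 : ball T d T1 -> ball T d T2 ->
      {for s0, continuous (fun s => g s T1)} -> {for s0, continuous (fun s => g s T2)}.
    move=> b1 b2 c1; have Ns := nbhs_singleton Ns0.
    have V1 : V (g s0 T1) by apply: stay VT => //; exact: ballxx.
    have V2 : V (g s0 T2) by exact: stay V1.
    have nV1 : \forall s \near s0, V (g s T1).
      by apply: (near_comp (f := fun s => g s T1)) => //; exact: open_nbhs_nbhs.
    apply: (near_eq_continuous (f := fun s => sg (F (s, T2)))).
      apply: filterS2 Ns0 nV1 => s Nss /(stay _ _ _ Nss b1 b2) Vs2.
      by rewrite -gE (Vs _ Vs2).2.
    apply: (@continuous_comp _ _ _ (fun s => F (s, T2)) sg).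
      apply: (@continuous_comp _ _ _ (fun s => (s, T2)) F); last exact: Fc.
      by apply: continuous_pair; [exact: cvg_id|exact: cvg_cst].
    by rewrite -gE; have [] := sP _ (Vs _ V2).1.
  near=> T'; have bT' : ball T d T' by near: T'; exact: nbhsx_ballx.
  by split; apply: step => //; exact: ballxx.
apply: (@locally_constant_segment _ (fun s => g 0 1 = g s 1) 0 1 ler01) => // s0 _.
have [U [oU UT] /(_ _ UT)[V [sg [sV VT]]]] := sheets (pr (g s0 1)).
have [oV sP Vs _] := sV.
have nV : \forall s \near s0, V (g s 1).
  by apply: (near_comp (f := fun s => g s 1)) => //; exact: open_nbhs_nbhs.
apply: filterS nV => s Vs1.
suff -> : g s 1 = g s0 1 by [].
by rewrite -(Vs _ Vs1).2 -(Vs _ VT).2 !gE !(F1 s) !(F1 s0).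
Unshelve. all: by end_near. Qed.


Variables (X : topologicalType) (f : X -> B).
Hypothesis f_continuous : continuous f.

(** Points joined by a path in the fibre product of f and pr.  Working with pairs
    makes this an equivalence relation, and a lift of f is a choice of one point
    over each x in the class of (x0, m0). *)
Definition joined (z z' : X * E) := exists (gam : R -> X) (g : R -> E),
  [/\ continuous gam, continuous g, forall t, pr (g t) = f (gam t),
      (gam 0, g 0) = z & (gam 1, g 1) = z'].

Lemma joined_sym z z' : joined z z' -> joined z' z.
Proof.
move=> [gam [g [gamc gc gE z0 z1]]].
have rc : continuous (fun t : R => 1 - t).
  by move=> t; apply: cvgB; [exact: cvg_cst|exact: cvg_id].
exists (fun t => gam (1 - t)), (fun t => g (1 - t)); split.
- by move=> t; apply: (@continuous_comp _ _ _ (fun t : R => 1 - t) gam); [exact: rc|exact: gamc].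
- by move=> t; apply: (@continuous_comp _ _ _ (fun t : R => 1 - t) g); [exact: rc|exact: gc].
- by move=> t; exact: gE.
- by rewrite subr0.
- by rewrite subrr.
Qed.

Lemma continuous_concat (T : topologicalType) (a b : R -> T) :
  continuous a -> continuous b -> a 1 = b 0 ->
  continuous (fun t : R => if t <= 2^-1 then a (2 * t) else b (2 * t - 1)).
Proof.
move=> ac bc ab; have c2 : continuous (fun t : R => 2 * t).
  by move=> t; apply: cvgM; [exact: cvg_cst|exact: cvg_id].
have c21 : continuous (fun t : R => 2 * t - 1).
  by move=> t; apply: cvgB; [exact: c2|exact: cvg_cst].
apply: (@continuous_glue T (fun t => a (2 * t)) (fun t => b (2 * t - 1))).
- by rewrite mulfV// subrr.
- by move=> t _; apply: (@continuous_comp _ _ _ (fun t : R => 2 * t) a); [exact: c2|exact: ac].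
- by move=> t _; apply: (@continuous_comp _ _ _ (fun t : R => 2 * t - 1) b); [exact: c21|exact: bc].
Qed.

Lemma joined_trans z1 z2 z3 : joined z1 z2 -> joined z2 z3 -> joined z1 z3.
Proof.
move=> [gam [g [gamc gc gE a0 a1]]] [del [d [delc dc dE b0 b1]]].
have [e1 e2] : gam 1 = del 0 /\ g 1 = d 0.
  by move: a1; rewrite -b0 => -[-> ->].
have half0 : (0 : R) <= 2^-1 by rewrite invr_ge0.
have half1 : ((1 : R) <= 2^-1) = false by apply/negbTE; rewrite -ltNge invf_lt1// ltr1n.
exists (fun t => if t <= 2^-1 then gam (2 * t) else del (2 * t - 1)),
  (fun t => if t <= 2^-1 then g (2 * t) else d (2 * t - 1)); split.
- exact: continuous_concat.
- exact: continuous_concat.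
- by move=> t; case: ifP.
- by rewrite half0 mulr0.
- by rewrite half1 mulr1 (_ : 2 - 1 = 1 :> R)//; ring.
Qed.

Hypothesis X_simply_connected : simply_connected R X.

Lemma continuous_clamp (T : topologicalType) (a : R -> T) :
  continuous a -> continuous (fun t => a (clamp t)).
Proof.
move=> ac t; apply: (@continuous_comp _ _ _ clamp a); last exact: ac.
exact: clamp_continuous.
Qed.

Lemma clampK t : clamp (clamp t) = clamp t.
Proof. by rewrite clamp_id// clamp01. Qed.

(** A loop in X contracts, and its lifts keep the same endpoint during the
    contraction, which ends at the constant path. *)
Lemma joined_loop x m m' : joined (x, m) (x, m') -> m = m'.
Proof.
move=> [gam [g [gamc gc gE [g0 m0] [g1 m1]]]].
have [_ _ contract] := X_simply_connected.
have [H [Hc HE]] := contract gam gamc (etrans g0 (esym g1)).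
pose F (z : R * R) := f (H (clamp z.1, clamp z.2)).
have Fc : continuous F.
  move=> z; apply: (@continuous_comp _ _ _ (fun z : R * R => H (clamp z.1, clamp z.2)) f); last exact: f_continuous.
  apply: (@continuous_comp _ _ _ (fun z : R * R => (clamp z.1, clamp z.2)) H); last exact: Hc.
  apply: continuous_pair.
    by apply: (@continuous_comp _ _ _ fst clamp); [exact: cvg_fst|exact: clamp_continuous].
  by apply: (@continuous_comp _ _ _ snd clamp); [exact: cvg_snd|exact: clamp_continuous].
have Hs s t : [/\ H (0, clamp t) = gam (clamp t), H (1, clamp t) = gam 0,
    H (clamp s, 0) = gam 0 & H (clamp s, 1) = gam 0].
  by apply: HE; rewrite in_itv /= clamp01.
have F0 t : F (0, t) = f (gam (clamp t)).
  by rewrite /F /= clamp0; have [-> _ _ _] := Hs 0 t.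
have F1 t : F (1, t) = f x by rewrite /F /= clamp1; have [_ -> _ _] := Hs 0 t; rewrite g0.
have Fs0 s : F (s, 0) = f x by rewrite /F /= clamp0; have [_ _ -> _] := Hs s 0; rewrite g0.
have Fs1 s : F (s, 1) = f x by rewrite /F /= clamp1; have [_ _ _ ->] := Hs s 0; rewrite g0.
have lift s : exists k : R -> E, [/\ continuous k, k 0 = m & forall t, pr (k t) = F (s, t)].
  have Fsc : continuous (fun t => F (s, t)).
    move=> t; apply: (@continuous_comp _ _ _ (fun t => (s, t)) F); last exact: Fc.
    by apply: continuous_pair; [exact: cvg_cst|exact: cvg_id].
  have [|k [kc k0 kE]] := path_lifting Fsc (e := m); first by rewrite Fs0 -m0 gE g0.
  by exists k; split=> // t; rewrite kE /F /= clampK.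
pose k s := projT1 (cid (lift s)).
have kP s : [/\ continuous (k s), k s 0 = m & forall t, pr (k s t) = F (s, t)].
  by rewrite /k; case: cid.
have k01 : k 0 1 = k 1 1.
  apply: (@endpoint_locally_constant F k m) => //.
  - by move=> s; have [] := kP s.
  - by move=> s t; have [_ _ ->] := kP s.
  - by move=> s; have [] := kP s.
  - by move=> s; rewrite !Fs1.
have -> : m = k 1 1.
  have [kc k0 kE] := kP 1.
  apply: (@unique_lift (fun=> m) (k 1)) => //; first by move=> t; exact: cvg_cst.
  by move=> t; rewrite kE F1 -m0 gE g0.
rewrite -k01 -m1 -[X in g X]clamp1; apply/esym.
have [kc k0 kE] := kP 0.
apply: (@unique_lift (fun t => g (clamp t)) (k 0)) => //.
- exact: continuous_clamp.
- by move=> t; rewrite kE F0 gE.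
- by rewrite clamp0 k0 m0.
Qed.

Hypothesis X_locally_path_connected : forall (x : X) (W : set X), nbhs x W ->
  \forall x' \near x, exists gam : R -> X,
    [/\ continuous gam, gam 0 = x, gam 1 = x' & forall t, W (gam t)].

Lemma exists_lift (x0 : X) (m0 : E) : pr m0 = f x0 ->
  exists phi : X -> E, (forall x, pr (phi x) = f x) /\
    forall x U V s, open U -> sheet U V s -> V (phi x) ->
      \forall x' \near x, phi x' = s (f x').
Proof.
move=> m0E; have [_ conn _] := X_simply_connected.
have ex_m x : exists m, joined (x0, m0) (x, m).
  have [gam [gamc gam0 gam1]] := conn x0 x.
  have fgc : continuous (f \o gam) by move=> t; apply: continuous_comp; [exact: gamc|exact: f_continuous].
  have [|g [gc g0 gE]] := path_lifting fgc (e := m0); first by rewrite /= gam0.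
  exists (g 1), (fun t => gam (clamp t)), g; split=> //.
  - exact: continuous_clamp.
  - by rewrite clamp0 gam0 g0.
  - by rewrite clamp1 gam1.
pose phi x := projT1 (cid (ex_m x)).
have phiP x : joined (x0, m0) (x, phi x) by exact: projT2 (cid (ex_m x)).
exists phi; split=> [x|x U V s oU sV Vx].
  have [gam [g [_ _ gE _ [gam1 g1]]]] := phiP x.
  by rewrite -g1 gE gam1.
have [oV sP Vs _] := sV.
have prphi : pr (phi x) = f x.
  by have [gam [g [_ _ gE _ [gam1 g1]]]] := phiP x; rewrite -g1 gE gam1.
have nU : nbhs x (f @^-1` U).
  by apply: f_continuous; apply: open_nbhs_nbhs; split=> //; rewrite -prphi; exact: (Vs _ Vx).1.
apply: filterS (X_locally_path_connected nU) => x' [gam [gamc gam0 gam1 gamU]].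
have short : joined (x, phi x) (x', s (f x')).
  exists gam, (fun t => s (f (gam t))); split=> //.
  - move=> t; apply: (@continuous_comp _ _ _ (f \o gam) s).
      by apply: continuous_comp; [exact: gamc|exact: f_continuous].
    by have [] := sP _ (gamU t).
  - by move=> t; have [] := sP _ (gamU t).
  - by rewrite gam0 -prphi (Vs _ Vx).2.
  - by rewrite gam1.
have := joined_trans (joined_sym (phiP x')) (joined_trans (phiP x) short).
exact: joined_loop.
Qed.

End PathLifting.

(** * Smooth coverings and smooth lifts *)
Section SmoothCoverings.
Context {R : realType} {n : nat} {E B : manifold R n}.
Variable pr : E -> B.
Hypothesis pr_covering : smooth_covering pr.

Lemma smooth_sheets b : exists2 U, open_nbhs b U & forall e, U (pr e) ->
  exists V s, [/\ sheet pr U V s, V e & forall y, U y -> smooth_map_at s y].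
Proof.
have [_ _ /(_ b)[U Ub [S [oS dS cS sS]]]] := pr_covering.
exists U => // e Ue.
have : (\bigcup_(V in S) V) e by rewrite cS.
move=> [V SV Ve]; have [s [s1 s2 s3]] := sS V SV.
exists V, s; split=> //; split.
- exact: oS.
- move=> y Uy; have [Vs ps] := s2 y Uy; split=> //; exact: (s1 y Uy).1.
- move=> x Vx; split; last exact: s3.
  by rewrite -[U _]/((pr @^-1` U) x) -cS; exists V.
- move=> x Ux nVx; have : (\bigcup_(V in S) V) x by rewrite cS.
  move=> [V' SV' V'x]; have : \forall x' \near x, V' x'.
    by apply: open_nbhs_nbhs; split=> //; exact: oS.
  apply: filterS => x' V'x' Vx'; apply: nVx.
  by rewrite -(dS V' V SV' SV)//; exists x'.
Qed.

Lemma topological_sheets b : exists2 U, open_nbhs b U & forall e, U (pr e) ->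
  exists V s, sheet pr U V s /\ V e.
Proof.
have [U Ub sU] := smooth_sheets b; exists U => // e /sU[V [s [sV Ve _]]].
by exists V, s.
Qed.

Lemma covering_smooth x : smooth_map_at pr x.
Proof. by have [] := pr_covering. Qed.

Lemma near_open (T : topologicalType) (U : set T) x : open U -> U x -> \forall y \near x, U y.
Proof. by move=> oU Ux; exact: open_nbhs_nbhs. Qed.

Lemma covering_tangent_inverse e : exists T : 'rV[R]_n -> 'rV[R]_n,
  (forall v, tangent pr e (T v) = v) /\ (forall v, T (tangent pr e v) = v).
Proof.
have [U [oU Ue] /(_ e Ue)[V [s [[oV sP Vs _] Ve ss]]]] := smooth_sheets (pr e).
have se : s (pr e) = e by exact: (Vs e Ve).2.
have ss' := ss _ Ue; have prs := covering_smooth (s (pr e)).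
have s_pr : smooth_map_at pr e by exact: covering_smooth.
exists (tangent s (pr e)); split=> v.
  have := tangent_comp v ss' prs; rewrite se => <-.
  rewrite (tangent_near_eq v _ (smooth_map_id (pr e))) ?tangent_id//.
  by apply: filterS (near_open oU Ue) => y Uy; have [_ _ E1] := sP y Uy; rewrite /= E1.
rewrite -(tangent_comp v s_pr ss').
rewrite (tangent_near_eq v _ (smooth_map_id e)) ?tangent_id//.
by apply: filterS (near_open oV Ve) => y Vy; rewrite /= (Vs y Vy).2.
Qed.

End SmoothCoverings.

Section LocallyPathConnected.
Context {R : realType} {n : nat} (N : manifold R n).

Lemma manifold_locally_path_connected (x : N) (W : set N) : nbhs x W ->
  \forall x' \near x, exists gam : R -> N,
    [/\ continuous gam, gam 0 = x, gam 1 = x' & forall t, W (gam t)].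
Proof.
move=> nW; set c := chart_at x.
pose D := [set y | (chart_fun c @` chart_dom c) y /\ W (chart_inv c y)].
have nD : nbhs (coord x) D.
  by apply: filterI; [exact: near_chart_img (coord_img x)|exact: near_coord nW].
have cx := mem_chart_at x.
have star := near_comp (chart_fun_continuous cx) (near_star_shaped nD).
apply: filterS2 star (near_chart_dom cx) => x' st dx'.
pose y' := chart_fun c x'.
have Dt t : D (clamp t *: (y' - coord x) + coord x) by apply: st; exact: clamp01.
exists (fun t => chart_inv c (clamp t *: (y' - coord x) + coord x)); split.
- move=> t; apply: (@continuous_comp _ _ _ (fun t => clamp t *: (y' - coord x) + coord x) (chart_inv c)).
    apply: cvgD; last exact: cvg_cst.
    by apply: cvgZr_tmp; exact: clamp_continuous.
  by apply: chart_inv_continuous; exact: (Dt t).1.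
- by rewrite clamp0 scale0r add0r chart_inv_coord.
- by rewrite clamp1 scale1r subrK; exact: chart_funK.
- by move=> t; exact: (Dt t).2.
Qed.

End LocallyPathConnected.

Section SmoothLift.
Context {R : realType} {m n : nat} {X : manifold R m} {E B : manifold R n}.
Variables (pr : E -> B) (f : X -> B).

Lemma exists_smooth_lift : smooth_covering pr -> simply_connected R X ->
  (forall x, smooth_map_at f x) -> exists phi : X -> E,
  (forall x, smooth_map_at phi x) /\ (forall x, pr (phi x) = f x).
Proof.
move=> prc Xsc fs.
have [[x0 _] _ _] := Xsc.
have [_ /(_ (f x0) I)[m0 _ m0E] _] := prc.
have fcont : continuous f by move=> x; exact: (fs x).1.
have [phi [phiE phi_loc]] := exists_lift (topological_sheets prc) fcont Xsc
  (@manifold_locally_path_connected _ _ X) m0E.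
exists phi; split=> // x.
have [U [oU Ue] /(_ _ Ue)[V [s [sV Ve ss]]]] := smooth_sheets prc (pr (phi x)).
have near_phi := phi_loc x U V s oU sV Ve.
have Ufx : U (f x) by rewrite -phiE.
apply: (smooth_map_near_eq (f := s \o f)); last by apply: smooth_map_comp => //; exact: ss.
by apply: filterS near_phi => x' ->.
Qed.

End SmoothLift.

(** * The strict value of the bundle metric *)
Section StrictValue.
Context {R : realType} {n : nat} {P : manifold R n.+1} {M : manifold R n}.
Variables (p : P -> M) (act : R -> P -> P) (psi : field1 P) (h : field2 M).
Hypothesis bundle : circle_bundle p act.
Hypothesis connection : connection_form act psi.
Hypothesis h_metric : riemannian_metric h.

Lemma connection_generator_neq0 q : generator act q != 0.
Proof.
have [fpsi _ psiX] := connection; apply/eqP => X0.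
have := psiX q; rewrite X0 (linear_fun0 (fpsi q I).1) => /eqP.
by rewrite eq_sym oner_eq0.
Qed.

Lemma bundle_metric_inner_product eps q : 0 < eps ->
  inner_product (bundle_metric p h psi eps q).
Proof.
move=> e0; have [fpsi _ psiX] := connection.
have psi_l := (fpsi q I).1.
have hp := metric_inner_product (p q) h_metric; have [hl hs hpos] := hp.
split=> [a u v w|u v|u u0]; rewrite /bundle_metric /pullback2.
- by rewrite (tangent_linear p q) hl psi_l; ring.
- by rewrite hs [psi q u * _]mulrC.
have [pu|pu] := eqVneq (tangent p q u) 0.
  rewrite pu (inner_product0 hp) mulr0 add0r -expr2 exprn_even_gt0//=.
  have [a uE] := vertical_generator bundle (connection_generator_neq0 q) pu.
  have := psi_l a (generator act q) 0.
  rewrite addr0 -uE psiX mulr1 (linear_fun0 psi_l) addr0 => ->.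
  by apply: contraNneq u0 => a0; rewrite uE a0 scale0r.
by rewrite ltr_pwDl ?mulr_gt0 ?invr_gt0 ?hpos// -expr2 sqr_ge0.
Qed.

Lemma opp_connection_primitive :
  primitive_of (fun q u v => - ext1 psi q u v) (fun q v => - psi q v).
Proof.
have [fpsi _ _] := connection; have [fN dN] := form1_opp fpsi; split=> //.
by apply/funext => q; apply/funext => u; apply/funext => v; exact: dN.
Qed.

Lemma opp_connection_norm eps q : 0 < eps ->
  dual_norm (bundle_metric p h psi eps) q (fun v => - psi q v) <= 1.
Proof.
move=> e0; apply: dual_norm_le.
  by rewrite (inner_product0 (bundle_metric_inner_product q e0)).
move=> v gv; rewrite normrN -(@expr_le1 _ 2)// real_normK ?num_real//.
have e1 : 0 <= eps^-1 by rewrite invr_ge0 ltW.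
apply: le_trans gv; rewrite /bundle_metric -expr2 lerDr mulr_ge0//.
exact: (inner_product_ge0 _ (metric_inner_product (p q) h_metric)).
Qed.

(** The generator is a unit vector of the bundle metric. *)
Lemma generator_le_dual_norm eps q (a : 'rV[R]_n.+1 -> R) : 0 < eps ->
  (forall b u v, a (b *: u + v) = b * a u + a v) ->
  `|a (generator act q)| <= dual_norm (bundle_metric p h psi eps) q a.
Proof.
move=> e0 al; have [_ _ psiX] := connection.
apply: dual_norm_ge => //; first exact: bundle_metric_inner_product.
rewrite /bundle_metric /pullback2 (tangent_p_generator bundle) psiX mulr1.
by rewrite (inner_product0 (metric_inner_product _ h_metric)) mulr0 add0r.
Qed.

Hypothesis P_connected : forall q q' : P,
  exists gam : R -> P, [/\ continuous gam, gam 0 = q & gam 1 = q'].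
Hypothesis P_nonempty : [set: P] !=set0.
Variable Omega : field2 M.
Hypothesis Omega_nonzero : ~ exact_form2 Omega.
Hypothesis curvature : pullback2 p Omega = (fun q u v => - ext1 psi q u v).

Lemma strict_value_bundle eps : 0 < eps ->
  strict_mane_value (kinetic (bundle_metric p h psi eps))
    (fun q u v => - ext1 psi q u v) = (1 / 2)%:E.
Proof.
move=> e0; have [fpsi psi_inv psiX] := connection.
apply/eqP; rewrite eq_le; apply/andP; split.
  apply: ge_ereal_inf; eexists.
    by exists (fun q v => - psi q v); [exact: opp_connection_primitive|reflexivity].
  apply: ge_ereal_sup => _ [q _ <-]; rewrite lee_fin /kinetic mul1r.
  by rewrite ler_piMr ?invr_ge0// exprn_ile1 ?dual_norm_ge0// opp_connection_norm.
apply: le_ereal_inf_tmp => _ [theta [ftheta dtheta] <-].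
rewrite leNgt; apply/negP => small; apply: Omega_nonzero.
(* the coefficient 1 puts tau in the shape of [form1_linear] and [ext1_linear] *)
pose tau : field1 P := fun q v => 1 * theta q v + psi q v.
apply: (@transverse_closed_form_exact _ _ _ _ p act bundle connection_generator_neq0 psi tau) => //.
- exact: form1_linear.
- move=> q u v; rewrite ext1_linear// dtheta mul1r addNr//.
move=> q; rewrite /tau mul1r psiX.
have Hq : kinetic (bundle_metric p h psi eps) q (theta q) < 1 / 2.
  rewrite -lte_fin; apply: le_lt_trans small; apply: ereal_sup_ubound.
  by exists q.
have d1 : dual_norm (bundle_metric p h psi eps) q (theta q) < 1.
  rewrite -(@expr_lt1 _ 2)// ?dual_norm_ge0//.
  by move: Hq; rewrite /kinetic mul1r gtr_pMr// invr_gt0.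
have := generator_le_dual_norm q e0 (ftheta q I).1.
move=> /le_lt_trans/(_ d1); rewrite ltr_norml => /andP[H _].
by rewrite -ltrBlDr sub0r.
Qed.

End StrictValue.

(** * The value on the universal cover *)
Section LiftedValue.
Context {R : realType} {n : nat} {P Pt : manifold R n.+1} {M Mt : manifold R n}.
Variables (prM : Mt -> M) (prP : Pt -> P).
Variables (p : P -> M) (act : R -> P -> P) (psi : field1 P) (h : field2 M).
Variable Omega : field2 M.
Hypothesis M_compact : compact [set: M].
Hypothesis Mt_covering : smooth_covering prM.
Hypothesis bounded : has_bounded_primitive prM Omega.
Hypothesis bundle : circle_bundle p act.
Hypothesis connection : connection_form act psi.
Hypothesis curvature : pullback2 p Omega = (fun q u v => - ext1 psi q u v).
Hypothesis h_metric : riemannian_metric h.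
Hypothesis Pt_universal : universal_cover prP.
Local Open Scope ereal_scope.

Lemma pullback_inner_product (k : field2 M) x : riemannian_metric k ->
  inner_product (pullback2 prM k x).
Proof.
move=> km; have [kl ks kp] := metric_inner_product (prM x) km.
have [T [_ TK]] := covering_tangent_inverse Mt_covering x.
split=> [a u v w|u v|u u0]; rewrite /pullback2 ?(tangent_linear prM x)//.
apply: kp; apply: contraNneq u0 => pu.
have pr0 : tangent prM x 0%R = 0%R.
  exact: (linear0 (linear_map (tangent_linear prM x))).
have T0 : T 0%R = 0%R by have := TK 0%R; rewrite pr0.
by rewrite -(TK u) pu T0.
Qed.

Lemma mane_value_ge0 (g : field2 P) (sigma : field2 P) :
  0 <= mane_value prP (kinetic g) sigma.
Proof.
have [_ [[x0 _] _ _]] := Pt_universal.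
apply: le_ereal_inf_tmp => _ [theta _ <-]; apply: le_ereal_sup_tmp.
eexists; first by exists x0; [|reflexivity].
by rewrite lee_fin /lift_hamiltonian /kinetic mulr_ge0// ?invr_ge0// sqr_ge0.
Qed.

(** The competitor is the pullback of the bounded primitive by the lift phi of the
    projection to M.  Its norm is controlled by the h-length of projected vectors,
    which is at most the square root of eps times their g_eps-length. *)
Lemma mane_value_bundle_le : exists C : R, forall eps : R, (0 < eps)%R ->
  mane_value prP (kinetic (bundle_metric p h psi eps))
    (fun q u v => - ext1 psi q u v)%R <= (eps * C)%:E.
Proof.
have [Pt_cov Pt_sc] := Pt_universal.
have [k [t [C [km [ft dt] tC]]]] := bounded.
have [K K0 kh] := metric_comparison M_compact km h_metric.
have p_smooth q : smooth_map_at p q by have [[]] := bundle.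
have prP_smooth x := covering_smooth Pt_cov x.
have prM_smooth x := covering_smooth Mt_covering x.
have [phi [phi_smooth phiE]] := exists_smooth_lift Mt_covering Pt_sc
  (fun x => smooth_map_comp (prP_smooth x) (p_smooth (prP x))).
have TphiE x v : tangent prM (phi x) (tangent phi x v) =
    tangent p (prP x) (tangent prP x v).
  rewrite -(tangent_comp v (phi_smooth x) (prM_smooth _)).
  rewrite -(tangent_comp v (prP_smooth x) (p_smooth _)).
  by congr (tangent _ x v); apply/funext => y; exact: phiE.
pose Theta : field1 Pt := fun x v => t (phi x) (tangent phi x v).
have loc (x : Pt) : \forall x' \near x, smooth_map_at phi x' /\
    forall v, Theta x' v = t (phi x') (tangent phi x' v).
  by apply: nearW => x'; split=> //; exact: phi_smooth.
have Theta_primitive : primitive_of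
    (pullback2 prP (fun q u v => - ext1 psi q u v)%R) Theta.
  split.
    move=> x _; split=> [a u v|u]; last exact: (pullback_local ft (loc x)).1.
    by rewrite /Theta (tangent_linear phi x) (ft _ I).1.
  apply/funext => x; apply/funext => u; apply/funext => v.
  rewrite (pullback_local ft (loc x)).2 dt -curvature /pullback2 !TphiE.
  by rewrite phiE.
exists (2^-1 * (K * C ^+ 2))%R => eps e0.
apply: ge_ereal_inf; eexists; first by exists Theta; [exact: Theta_primitive|reflexivity].
apply: ge_ereal_sup => _ [x _ <-]; rewrite lee_fin /lift_hamiltonian /kinetic.
rewrite [leRHS]mulrCA ler_wpM2l ?invr_ge0//.
set a := fun u => _.
have Ke : (0 < K * eps)%R by exact: mulr_gt0.
have C0 : (0 <= C)%R by apply: le_trans (tC (phi x)); exact: dual_norm_ge0.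
suff : (dual_norm (bundle_metric p h psi eps) (prP x) a <= Num.sqrt (K * eps) * C)%R.
  move=> ale; apply: (@le_trans _ _ ((Num.sqrt (K * eps) * C) ^+ 2)%R).
    by rewrite ler_sqr// ?nnegrE ?dual_norm_ge0// mulr_ge0// sqrtr_ge0.
  by rewrite exprMn sqr_sqrtr ?(ltW Ke)// [leRHS]mulrCA mulrA.
apply: dual_norm_le => [|v gv].
  by rewrite (inner_product0 (bundle_metric_inner_product bundle connection h_metric (prP x) e0)).
have [T [TK _]] := covering_tangent_inverse Pt_cov x.
set w := get [set w | tangent prP x w = v].
have wE : tangent prP x w = v by apply: (@getPex _ [set w | tangent prP x w = v]); exists (T v); exact: TK.
rewrite /a -/w.
have s0 : (0 < Num.sqrt (K * eps))%R by rewrite sqrtr_gt0.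
have tl := (ft (phi x) I).1.
have small : (pullback2 prM k (phi x) (tangent phi x w) (tangent phi x w) <= Num.sqrt (K * eps) ^+ 2)%R.
  rewrite sqr_sqrtr ?(ltW Ke)// /pullback2 !TphiE wE phiE /=.
  apply: le_trans (kh _ _) _; rewrite ler_pM2l//.
  have := gv; rewrite /bundle_metric /pullback2 -expr2 => gv'.
  have : (eps^-1 * h (p (prP x)) (tangent p (prP x) v) (tangent p (prP x) v) <= 1)%R.
    by apply: le_trans gv'; rewrite lerDl sqr_ge0.
  by rewrite mulrC ler_pdivrMr// mul1r.
apply: le_trans (dual_norm_scale (pullback_inner_product (phi x) km) tl s0 small) _.
by rewrite ler_pM2l.
Qed.

End LiftedValue.

Lemma covering_path_connected (R : realType) (n : nat) (E B : manifold R n) (pr : E -> B) :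
  universal_cover pr -> forall q q' : B, exists gam : R -> B,
    [/\ continuous gam, gam 0 = q & gam 1 = q'].
Proof.
move=> [cov [_ conn _]] q q'; have [_ surj _] := cov.
have [x _ <-] := surj q I; have [x' _ <-] := surj q' I.
have [gam [gamc g0 g1]] := conn x x'.
exists (pr \o gam); split; rewrite /= ?g0 ?g1//.
move=> t; apply: continuous_comp; first exact: gamc.
exact: (covering_smooth cov _).1.
Qed.

Unset Implicit Arguments.

Theorem theorem5p5 (R : realType) (n : nat)
  (M Mt : manifold R n) (prM : Mt -> M) (Omega : field2 M)
  (P Pt : manifold R n.+1) (prP : Pt -> P)
  (p : P -> M) (act : R -> P -> P) (psi : field1 P) (h : field2 M)
  (M_closed : compact [set: M])
  (Mt_universal : universal_cover prM)
  (Omega_closed : closed_form2 Omega)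
  (Omega_integral : integral_class Omega)
  (Omega_nonzero : ~ exact_form2 Omega)
  (Omega_bounded : has_bounded_primitive prM Omega)
  (P_bundle : circle_bundle p act)
  (P_euler : has_euler_class p act Omega)
  (psi_connection : connection_form act psi)
  (psi_curvature : pullback2 p Omega = (fun q u v => - ext1 psi q u v))
  (h_metric : riemannian_metric h)
  (Pt_universal : universal_cover prP) :
  (forall eps : R, 0 < eps ->
     strict_mane_value (kinetic (bundle_metric p h psi eps))
                       (fun q u v => - ext1 psi q u v) = (1 / 2)%:E) /\
  (mane_value prP (kinetic (bundle_metric p h psi eps))
              (fun q u v => - ext1 psi q u v) @[eps --> 0^'+] --> 0%E).
Proof.
split=> [eps e0|].
  apply: (@strict_value_bundle _ _ _ _ p act psi h P_bundle psi_connection h_metric _ _ Omega) => //.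
    exact: covering_path_connected Pt_universal.
  by have [_ [[x0 _] _ _]] := Pt_universal; exists (prP x0).
have [C HC] := mane_value_bundle_le M_closed Mt_universal.1 Omega_bounded P_bundle
  psi_connection psi_curvature h_metric Pt_universal.
apply: (@squeeze_cvge _ _ _ _ (fun=> 0%E) _ (fun eps : R => (eps * C)%:E)).
- near=> eps; apply/andP; split; first exact: mane_value_ge0.
  by apply: HC; near: eps; exact: nbhs_right_gt.
- exact: cvg_cst.
- apply: cvg_EFin; first by near=> eps.
  rewrite -[X in _ --> X](mul0r C); apply: cvgM; last exact: cvg_cst.
  by apply: cvg_within_filter; exact: cvg_id.
Unshelve. all: by end_near. Qed.
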